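(* Let $R$ be a skew-invertible Hecke symmetry (an $N^2\times N^2$ complex matrix), let $M=\|m_i^j\|$ and $D=\|\partial_i^j\|$ be the generating matrices of the algebras $\mathcal{M}(R)$ and $\mathcal{D}(R^{-1})$ in the quantum double, i.e. of the unital associative algebra generated by the $m_i^j,\partial_i^j$ subject to $$R\,M_1R\,M_1=M_1R\,M_1R,\qquad R^{-1}D_1R^{-1}D_1=D_1R^{-1}D_1R^{-1},\qquad D_1R\,M_1=R\,M_1R^{-1}D_1R^{-1}+I,$$ and let $L=MD$. Then for every integer $k\ge1$ the following identities hold: $$\langle A^{(k)}L_{\overline 1}(L_{\overline 2}+qI)\cdots(L_{\overline k}+q^{k-1}(k-1)_qI)\rangle_{1\dots k}=q^{k(k-1)}\langle A^{(k)}M_{\overline 1}\cdots M_{\overline k}\,D_{\overline k}\cdots D_{\overline 1}\rangle_{1\dots k},$$ $$\Big\langle S^{(k)}L_{\overline 1}\Big(L_{\overline 2}-\frac1qI\Big)\cdots\Big(L_{\overline k}-\frac{(k-1)_q}{q^{k-1}}I\Big)\Big\rangle_{1\dots k}=q^{-k(k-1)}\langle S^{(k)}M_{\overline 1}\cdots M_{\overline k}\,D_{\overline k}\cdots D_{\overline 1}\rangle_{1\dots k}.$$ The $j$-th factors after the projector on the left-hand sides ($1\le j\le k$) are $L_{\overline j}+q^{j-1}(j-1)_qI$ and $L_{\overline j}-q^{-(j-1)}(j-1)_qI$ respectively.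
   Context: Ground field $\mathbb{C}$; $N\ge1$. $R$ is a numerical $N^2\times N^2$ matrix acting on $V\otimes V$, $V=\mathbb{C}^N$. It is a braiding if it is a solution of $R_{12}R_{23}R_{12}=R_{23}R_{12}R_{23}$, where $R_{12}=R\otimes I$, $R_{23}=I\otimes R$. It is a Hecke symmetry if it is a braiding and $(qI\otimes I-R)(q^{-1}I\otimes I+R)=0$ with $q\in\mathbb{C}$, $q\notin\{0,\pm1\}$ (so $R$ is invertible). It is skew-invertible if there is an $N^2\times N^2$ matrix $\Psi$ with $\mathrm{Tr}_{(2)}R_{12}\Psi_{23}=\mathrm{Tr}_{(2)}\Psi_{12}R_{23}=P_{13}$, where $P$ is the flip and $\mathrm{Tr}_{(2)}$ is the usual trace over the second tensor factor. Evenness of $R$ is not assumed. $R$-trace (quantum trace): with the $N\times N$ matrix $C=\mathrm{Tr}_{(2)}\Psi_{12}$, put $\mathrm{Tr}_RX=\mathrm{Tr}(CX)$ for an $N\times N$ matrix $X$ (equivalently, normalized so that $\mathrm{Tr}_{R(2)}R_{12}=I_1$). For an $N^k\times N^k$ matrix $X$, $\langle X\rangle_{1\dots k}=\mathrm{Tr}_{R(1)}\cdots\mathrm{Tr}_{R(k)}X=\mathrm{Tr}_{(1\dots k)}(C_1\cdots C_kX)$, where $C_i$ is $C$ acting in the $i$-th tensor factor. $q$-integers: $k_q=\dfrac{q^k-q^{-k}}{q-q^{-1}}$; it is assumed that $k_q\neq0$ for all $k\ge1$. For a matrix $X=\|x_i^j\|_{1\le i,j\le N}$ ($i$ is the row index,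 $j$ the column index) with entries in a possibly noncommutative algebra, $X_1=X\otimes I$; products of matrices are usual matrix products with the order of the entries preserved, so $L=MD$ has entries $l_i^j=\sum_k m_i^k\partial_k^j$. In the relation between $D$ and $M$ the symbol $I$ is the identity on $V\otimes V$. $\mathcal{M}(R)$ is the unital associative algebra generated by the $m_i^j$ with the first of the displayed relations; $\mathcal{D}(R^{-1})$ is the one generated by the $\partial_i^j$ with the second; the third relation is the permutation relation of the quantum double. On $V^{\otimes k}$ put $R_i=I^{\otimes(i-1)}\otimes R\otimes I^{\otimes(k-i-1)}$. For $X=M,D,L$ (the first copy acting in the first tensor factor) the copies are $X_{\overline 1}=X_1$, $X_{\overline{i+1}}=R_iX_{\overline i}R_i^{-1}$. In the identities of the claim $I$ is the identity on $V^{\otimes k}$. The $R$-skew-symmetrizers $A^{(k)}$ and $R$-symmetrizers $S^{(k)}$ acting on $V^{\otimes k}$ are defined by $A^{(1)}=S^{(1)}=I$ and, for $k\ge2$, $$A^{(k)}_{1\dots k}=\frac1{k_q}A^{(k-1)}_{1\dots k-1}\big(q^{k-1}I^{\otimes k}-(k-1)_qR_{k-1}\big)A^{(k-1)}_{1\dots k-1},$$ $$S^{(k)}_{1\dots k}=\frac1{k_q}S^{(k-1)}_{1\dots k-1}\big(q^{-(k-1)}I^{\otimes k}+(k-1)_qR_{k-1}\big)S^{(k-1)}_{1\dots k-1},$$ where the subscript $1\dots k-1$ means acting in the first $k-1$ tensor factors. *)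

(* Defs.v *)
From HB Require Import structures.
From mathcomp Require Import all_boot all_order all_algebra.
From mathcomp Require Import generic_quotient ring_quotient.
From mathcomp Require Import boolp reals complex mxtens monalg.

Set Implicit Arguments.
Unset Strict Implicit.
Unset Printing Implicit Defensive.

Import GRing.Theory.
Local Open Scope ring_scope.
Local Open Scope quotient_scope.

(* The unital associative F-algebra with generators indexed by I and relators
   rel: the monoid algebra of the free monoid on I modulo the two-sided ideal
   generated by the elements satisfying rel. *)
Section PresentedAlgebra.
Variables (F : fieldType) (I : choiceType).
Local Notation A := {malg F[{fmonom I}]}.

Lemma free_scalerAr (c : F) (x y : A) : c *: (x * y) = x * (c *: y).
Proof.
have cU k (d : F) : c *: (<< d *g k >> : A) = << c * d *g k >>.
  by apply/malgP=> k'; rewrite mcoeffZ !mcoeffU mulrnAr.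
rewrite (monalgE x) (monalgE y) !mulr_suml scaler_sumr.
apply: eq_bigr => k _; rewrite mulr_sumr !scaler_sumr mulr_sumr.
apply: eq_bigr => l _; rewrite cU.
by rewrite !malgM_def !fgmulUU cU mulrCA.
Qed.

Variable rel : A -> Prop.

Inductive ideal_gen : A -> Prop :=
| ideal_gen0 : ideal_gen 0
| ideal_genD a r b x :
    rel r -> ideal_gen x -> ideal_gen (a * r * b + x).

Definition ideal_pred : {pred A} := fun x => `[< ideal_gen x >].

Lemma ideal_predP x : reflect (ideal_gen x) (x \in ideal_pred).
Proof. exact: asboolP. Qed.

Lemma ideal_genDD x y : ideal_gen x -> ideal_gen y -> ideal_gen (x + y).
Proof.
elim=> [|a r b z rr _ IH] Hy; first by rewrite add0r.
by rewrite -addrA; apply: ideal_genD => //; apply: IH.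
Qed.

Lemma ideal_genN x : ideal_gen x -> ideal_gen (- x).
Proof.
elim=> [|a r b z rr _ IH]; first by rewrite oppr0; apply: ideal_gen0.
by rewrite opprD -!mulNr; apply: ideal_genD.
Qed.

Lemma ideal_genMl a x : ideal_gen x -> ideal_gen (a * x).
Proof.
elim=> [|c r b z rr _ IH]; first by rewrite mulr0; apply: ideal_gen0.
by rewrite mulrDr !mulrA; apply: ideal_genD.
Qed.

Lemma ideal_genMr a x : ideal_gen x -> ideal_gen (x * a).
Proof.
elim=> [|c r b z rr _ IH]; first by rewrite mul0r; apply: ideal_gen0.
by rewrite mulrDl -[_ * _ * a]mulrA; apply: ideal_genD.
Qed.

Lemma ideal_gen_zmod : zmod_closed ideal_pred.
Proof.
split; first by apply/ideal_predP; apply: ideal_gen0.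
move=> x y /ideal_predP Hx /ideal_predP Hy; apply/ideal_predP.
by apply: ideal_genDD => //; apply: ideal_genN.
Qed.

HB.instance Definition _ := GRing.isZmodClosed.Build A ideal_pred ideal_gen_zmod.

Definition pres_alg : Type := Quotient.quot (ideal_pred : zmodClosed A).
HB.instance Definition _ := GRing.Zmodule.on pres_alg.

Definition pres (x : A) : pres_alg := \pi_(Quotient.quot _) x.

Lemma pres_eq x y : pres x = pres y <-> ideal_gen (x - y).
Proof.
rewrite /pres; split.
  by move/eqP; rewrite -Quotient.idealrBE => /ideal_predP.
by move=> H; apply/eqP; rewrite -Quotient.idealrBE; apply/ideal_predP.
Qed.

Definition pres_repr (u : pres_alg) : A := repr (u : Quotient.quot _).

Lemma pres_reprK : cancel pres_repr pres.
Proof. by move=> u; apply: reprK. Qed.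

Lemma pres_is_zmod_morphism : zmod_morphism pres.
Proof. exact: pi_is_zmod_morphism. Qed.

HB.instance Definition _ :=
  GRing.isZmodMorphism.Build A pres_alg pres pres_is_zmod_morphism.

Lemma pres_ind (P : pres_alg -> Prop) : (forall x, P (pres x)) -> forall u, P u.
Proof. by move=> H u; rewrite -(pres_reprK u). Qed.

Definition pres_one : pres_alg := pres 1.
Definition pres_mul (u v : pres_alg) : pres_alg :=
  pres (pres_repr u * pres_repr v).
Definition pres_scale (c : F) (u : pres_alg) : pres_alg :=
  pres (c *: pres_repr u).

Lemma pres_mulE x y : pres_mul (pres x) (pres y) = pres (x * y).
Proof.
apply/pres_eq; set x' := pres_repr _; set y' := pres_repr _.
have -> : x' * y' - x * y = (x' - x) * y' + x * (y' - y).
  by rewrite mulrBl mulrBr addrA subrK.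
apply: ideal_genDD; [apply: ideal_genMr|apply: ideal_genMl];
  by apply/pres_eq; rewrite pres_reprK.
Qed.

Lemma pres_scaleE c x : pres_scale c (pres x) = pres (c *: x).
Proof.
apply/pres_eq; rewrite -scalerBr -[_ - x]mul1r scalerAl.
by apply: ideal_genMl; apply/pres_eq; rewrite pres_reprK.
Qed.

Lemma pres_mulA : associative pres_mul.
Proof.
elim/pres_ind=> x; elim/pres_ind=> y; elim/pres_ind=> z.
by rewrite !pres_mulE mulrA.
Qed.

Lemma pres_mul1l : left_id pres_one pres_mul.
Proof. by elim/pres_ind=> x; rewrite pres_mulE mul1r. Qed.

Lemma pres_mul1r : right_id pres_one pres_mul.
Proof. by elim/pres_ind=> x; rewrite pres_mulE mulr1. Qed.

Lemma pres_mulDl : left_distributive pres_mul +%R.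
Proof.
elim/pres_ind=> x; elim/pres_ind=> y; elim/pres_ind=> z.
by rewrite -raddfD !pres_mulE mulrDl raddfD.
Qed.

Lemma pres_mulDr : right_distributive pres_mul +%R.
Proof.
elim/pres_ind=> x; elim/pres_ind=> y; elim/pres_ind=> z.
by rewrite -raddfD !pres_mulE mulrDr raddfD.
Qed.

HB.instance Definition _ := GRing.Zmodule_isPzRing.Build pres_alg
  pres_mulA pres_mul1l pres_mul1r pres_mulDl pres_mulDr.

Lemma pres_scaleA a b u : pres_scale a (pres_scale b u) = pres_scale (a * b) u.
Proof. by elim/pres_ind: u => x; rewrite !pres_scaleE scalerA. Qed.

Lemma pres_scale1 : left_id 1 pres_scale.
Proof. by elim/pres_ind=> x; rewrite pres_scaleE scale1r. Qed.

Lemma pres_scaleDr : right_distributive pres_scale +%R.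
Proof.
move=> c; elim/pres_ind=> x; elim/pres_ind=> y.
by rewrite -raddfD !pres_scaleE scalerDr raddfD.
Qed.

Lemma pres_scaleDl u : {morph pres_scale^~ u : a b / a + b}.
Proof.
by elim/pres_ind: u => x a b; rewrite !pres_scaleE scalerDl raddfD.
Qed.

HB.instance Definition _ := GRing.Zmodule_isLmodule.Build F pres_alg
  pres_scaleA pres_scale1 pres_scaleDr pres_scaleDl.

Lemma pres_is_monoid_morphism : monoid_morphism pres.
Proof. by split=> [|x y]; [exact: erefl|exact: (esym (pres_mulE x y))]. Qed.

HB.instance Definition _ :=
  GRing.isMonoidMorphism.Build A pres_alg pres pres_is_monoid_morphism.

Lemma pres_is_scalable : scalable pres.
Proof. by move=> c x; rewrite -pres_scaleE. Qed.

HB.instance Definition _ :=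
  GRing.isScalable.Build F A pres_alg *:%R pres pres_is_scalable.

Lemma pres_rel r : rel r -> pres r = 0.
Proof.
move=> Hr; rewrite -(raddf0 pres); apply/pres_eq.
have -> : r - 0 = 1 * r * 1 + 0 by rewrite mul1r mulr1 subr0 addr0.
by apply: ideal_genD => //; apply: ideal_gen0.
Qed.

Lemma pres_scalerAl (c : F) (u v : pres_alg) : c *: (u * v) = c *: u * v.
Proof.
elim/pres_ind: u => x; elim/pres_ind: v => y.
by rewrite -rmorphM -!linearZ -rmorphM scalerAl.
Qed.

Lemma pres_scalerAr (c : F) (u v : pres_alg) : c *: (u * v) = u * (c *: v).
Proof.
elim/pres_ind: u => x; elim/pres_ind: v => y.
by rewrite -rmorphM -!linearZ -rmorphM free_scalerAr.
Qed.

(* lalgType, hence in_alg, requires 1 != 0, which may fail for a general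
   presentation. *)
Definition pres_scal (c : F) : pres_alg := c *: (1 : pres_alg).

Lemma pres_scal_is_zmod_morphism : zmod_morphism pres_scal.
Proof. by move=> a b; rewrite /pres_scal scalerBl. Qed.

HB.instance Definition _ :=
  GRing.isZmodMorphism.Build F pres_alg pres_scal pres_scal_is_zmod_morphism.

Lemma pres_scal_is_monoid_morphism : monoid_morphism pres_scal.
Proof.
split; first exact: scale1r.
by move=> a b; rewrite /pres_scal -pres_scalerAl mul1r scalerA.
Qed.

HB.instance Definition _ :=
  GRing.isMonoidMorphism.Build F pres_alg pres_scal
    pres_scal_is_monoid_morphism.

Lemma pres_scalE c : pres_scal c = pres (c%:A : A).
Proof. by rewrite linearZ rmorph1. Qed.

End PresentedAlgebra.

(* Matrices acting on V^{(x)k}, V = F^N, have rows and columns indexed by the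
   multi-indices {ffun 'I_k -> 'I_N} through enum_val / enum_rank.  Matrices
   acting on V (x) V are also written as 'M_(N * N), with the indexing
   mxtens_index of the Kronecker product *t. *)
Notation "''T[' B ]_ ( N , k )" := 'M[B]_#|{ffun 'I_k -> 'I_N}|
  (at level 8, B, N, k at level 99, format "''T[' B ]_ ( N ,  k )") : type_scope.

Section Tensor.
Variables (B : pzRingType) (N : nat).

Definition tens_mx k (E : {ffun 'I_k -> 'I_N} -> {ffun 'I_k -> 'I_N} -> B) :
  'T[B]_(N, k) := \matrix_(s, t) E (enum_val s) (enum_val t).

(* X acting in the i-th tensor factor of V^{(x)(n+1)}, where factors are
   numbered from 1 to n+1. *)
Definition at1 n (i : nat) (X : 'M[B]_N) : 'T[B]_(N, n.+1) :=
  let p : 'I_n.+1 := inord i.-1 in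
  tens_mx (fun a b => X (a p) (b p) *+ [forall l, (l != p) ==> (a l == b l)]).

(* X acting in the i-th and (i+1)-st tensor factors of V^{(x)(n+1)},
   1 <= i <= n. *)
Definition at2 n (i : nat) (X : 'M[B]_(N * N)) : 'T[B]_(N, n.+1) :=
  let p : 'I_n.+1 := inord i.-1 in
  let p' : 'I_n.+1 := inord i in
  tens_mx (fun a b =>
    X (mxtens_index (a p, a p')) (mxtens_index (b p, b p'))
      *+ [forall l, (l != p) && (l != p') ==> (a l == b l)]).

(* Tr_(2) of a matrix acting on V^{(x)3}; the result acts on the first and
   third factors. *)
Definition ptrace2_3 (X : 'T[B]_(N, 3)) : 'M[B]_(N * N) :=
  let mi (s : 'I_(N * N)) (x : 'I_N) : {ffun 'I_3 -> 'I_N} :=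
    [ffun l => tnth [tuple (mxtens_unindex s).1; x; (mxtens_unindex s).2] l] in
  \matrix_(s, t) \sum_x X (enum_rank (mi s x)) (enum_rank (mi t x)).

Definition ptrace2_2 (X : 'M[B]_(N * N)) : 'M[B]_N :=
  \matrix_(i, j) \sum_x X (mxtens_index (i, x)) (mxtens_index (j, x)).

Definition flip_mx : 'M[B]_(N * N) :=
  \matrix_(s, t) (((mxtens_unindex s).1 == (mxtens_unindex t).2) &&
                  ((mxtens_unindex s).2 == (mxtens_unindex t).1))%:R.

End Tensor.

Section Hecke.
Variables (F : fieldType) (N : nat).
Implicit Types (q : F) (R Psi : 'M[F]_(N * N)).

Definition qint q (k : nat) : F := (q ^+ k - q ^- k) / (q - q^-1).

Definition braiding R : Prop :=
  at2 2 1 R *m at2 2 2 R *m at2 2 1 R = at2 2 2 R *m at2 2 1 R *m at2 2 2 R.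

Definition hecke_symmetry q R : Prop :=
  braiding R /\ (q%:M - R) *m (q^-1%:M + R) = 0.

Definition skew_inverse R Psi : Prop :=
  ptrace2_3 (at2 2 1 R *m at2 2 2 Psi) = flip_mx F N /\
  ptrace2_3 (at2 2 1 Psi *m at2 2 2 R) = flip_mx F N.

(* A^{(j)} and S^{(j)}, acting in the first j factors of V^{(x)(n+1)}. *)
Fixpoint skew_symmetrizer n q R (j : nat) : 'T[F]_(N, n.+1) :=
  if j is (i.+1 as p).+1 then
    (qint q j)^-1 *:
      (skew_symmetrizer n q R p *m ((q ^+ p)%:M - qint q p *: at2 n p R)
         *m skew_symmetrizer n q R p)
  else 1%:M.

Fixpoint symmetrizer n q R (j : nat) : 'T[F]_(N, n.+1) :=
  if j is (i.+1 as p).+1 then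
    (qint q j)^-1 *:
      (symmetrizer n q R p *m ((q ^- p)%:M + qint q p *: at2 n p R)
         *m symmetrizer n q R p)
  else 1%:M.

End Hecke.

Section MapMx.
Variables (A B : pzRingType) (f : {rmorphism A -> B}) (n : nat).

Lemma map_tens_mx1 m (X : 'M[A]_m) :
  map_mx f (X *t (1%:M : 'M_m)) = map_mx f X *t (1%:M : 'M_m).
Proof. by apply/matrixP=> s t; rewrite !mxE rmorphM /= rmorph_nat. Qed.

Lemma map_mx_eq (X Y : 'M[A]_n) :
  (forall s t, f ((X - Y) s t) = 0) -> map_mx f X = map_mx f Y.
Proof.
move=> H; apply/eqP; rewrite -subr_eq0 -map_mxB; apply/eqP/matrixP=> s t.
by rewrite mxE [RHS]mxE; apply: H.
Qed.

Lemma map_reflection (X Y : 'M[A]_n) X' Y' :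
  map_mx f X = X' -> map_mx f Y = Y' ->
  (forall s t, f ((X *m Y *m X *m Y - Y *m X *m Y *m X) s t) = 0) ->
  X' *m Y' *m X' *m Y' = Y' *m X' *m Y' *m X'.
Proof. by move=> <- <- /map_mx_eq; rewrite !map_mxM. Qed.

Lemma map_permutation (X Xi Y Z : 'M[A]_n) X' Xi' Y' Z' :
  map_mx f X = X' -> map_mx f Xi = Xi' -> map_mx f Y = Y' -> map_mx f Z = Z' ->
  (forall s t,
     f ((Z *m X *m Y - (X *m Y *m Xi *m Z *m Xi + 1%:M)) s t) = 0) ->
  Z' *m X' *m Y' = X' *m Y' *m Xi' *m Z' *m Xi' + 1%:M.
Proof.
by move=> <- <- <- <- /map_mx_eq; rewrite map_mxD map_mx1 !map_mxM.
Qed.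
End MapMx.

Section QuantumDouble.
Variables (F : fieldType) (N : nat) (R : 'M[F]_(N * N)).

(* inl (i, j) stands for m_i^j and inr (i, j) for \partial_i^j. *)
Definition qd_gen : Type := (('I_N * 'I_N) + ('I_N * 'I_N))%type.
HB.instance Definition _ := Choice.on qd_gen.

Local Notation A := {malg F[{fmonom qd_gen}]}.

Definition free_M : 'M[A]_N := \matrix_(i, j) << fmu (inl (i, j) : qd_gen) >>.
Definition free_D : 'M[A]_N := \matrix_(i, j) << fmu (inr (i, j) : qd_gen) >>.

Definition qd_rel (x : A) : Prop :=
  let R' : 'M[A]_(N * N) := map_mx (in_alg A) R in
  let Ri : 'M[A]_(N * N) := map_mx (in_alg A) (invmx R) in
  let M1 : 'M[A]_(N * N) := free_M *t 1%:M in
  let D1 : 'M[A]_(N * N) := free_D *t 1%:M in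
  exists s t : 'I_(N * N),
    [\/ x = (R' *m M1 *m R' *m M1 - M1 *m R' *m M1 *m R') s t,
        x = (Ri *m D1 *m Ri *m D1 - D1 *m Ri *m D1 *m Ri) s t |
        x = (D1 *m R' *m M1 - (R' *m M1 *m Ri *m D1 *m Ri + 1%:M)) s t].

Local Notation qdouble := (pres_alg qd_rel).
Local Notation qscal := (pres_scal qd_rel).

Definition qd_M : 'M[qdouble]_N := map_mx (pres qd_rel) free_M.
Definition qd_D : 'M[qdouble]_N := map_mx (pres qd_rel) free_D.
Definition qd_L : 'M[qdouble]_N := qd_M *m qd_D.

Lemma map_pres_scal m n (X : 'M[F]_(m, n)) :
  map_mx (pres qd_rel) (map_mx (in_alg A) X) = map_mx qscal X.
Proof. by rewrite -map_mx_comp; apply: eq_map_mx => c; rewrite /= pres_scalE. Qed.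

Section Relations.
Let R' := map_mx qscal R.
Let Ri := map_mx qscal (invmx R).
Let M1 : 'M[qdouble]_(N * N) := qd_M *t 1%:M.
Let D1 : 'M[qdouble]_(N * N) := qd_D *t 1%:M.

Lemma qd_MM : R' *m M1 *m R' *m M1 = M1 *m R' *m M1 *m R'.
Proof.
apply: (map_reflection (map_pres_scal R) (map_tens_mx1 (pres qd_rel) free_M)).
by move=> s t; apply: pres_rel; exists s, t; apply: Or31.
Qed.

Lemma qd_DD : Ri *m D1 *m Ri *m D1 = D1 *m Ri *m D1 *m Ri.
Proof.
apply: (map_reflection (map_pres_scal (invmx R))
          (map_tens_mx1 (pres qd_rel) free_D)).
by move=> s t; apply: pres_rel; exists s, t; apply: Or32.
Qed.

Lemma qd_DM : D1 *m R' *m M1 = R' *m M1 *m Ri *m D1 *m Ri + 1%:M.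
Proof.
apply: (map_permutation (map_pres_scal R) (map_pres_scal (invmx R))
          (map_tens_mx1 (pres qd_rel) free_M)
          (map_tens_mx1 (pres qd_rel) free_D)).
by move=> s t; apply: pres_rel; exists s, t; apply: Or33.
Qed.
End Relations.

(* X_{\overline i}, i >= 1, acting on V^{(x)(n+1)}. *)
Fixpoint mx_copy n (X : 'M[qdouble]_N) (i : nat) : 'T[qdouble]_(N, n.+1) :=
  if i is (h.+1 as p).+1 then
    map_mx qscal (at2 n p R) *m mx_copy n X p
      *m map_mx qscal (invmx (at2 n p R))
  else at1 n 1 X.

(* <X>_{1..n+1}, where Psi is the skew inverse of R. *)
Definition Rtrace (Psi : 'M[F]_(N * N)) n (X : 'T[qdouble]_(N, n.+1)) :
  qdouble :=
  \tr ((\prod_(1 <= i < n.+2) map_mx qscal (at1 n i (ptrace2_2 Psi))) * X).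

End QuantumDouble.

Notation qdouble R := (pres_alg (qd_rel R)).
Notation qscal R := (pres_scal (qd_rel R)).

(* Main.v *)
Require Import Defs.
From HB Require Import structures.
From mathcomp Require Import all_boot all_order all_algebra.
From mathcomp Require Import reals complex mxtens ring zify.

Set Implicit Arguments.
Unset Strict Implicit.
Unset Printing Implicit Defensive.

Import GRing.Theory.
Local Open Scope ring_scope.

(** Put lam = q - q^-1, J_1 = 1, J_(i+1) = R_i^-1 J_i R_i^-1 (the inverse
    Jucys-Murphy elements), x_i = (J_i - 1) / lam, and write T_k for the
    descending product D_k ... D_1 of copies.  Both identities are shadows of
    an identity without any trace or projector (universal_capelli):
      (L_1 + x_1) ... (L_k + x_k) = M_1 ... M_k T_k J_1 ... J_k.
    It follows by induction from desc_L,
      T_k (L_(k+1) + x_(k+1)) = M_(k+1) D_(k+1) T_k J_(k+1),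
    since J_1, ..., J_k commute with L_(k+1) and x_(k+1).  The identity desc_L
    is itself proved by induction: write L_(k+1) = R_k L_k R_k^-1, use the
    permutation relation and the reflection equation for D at level k
    (obtained from level 1 by conjugation with R_i R_(i+1), see
    braid_shift_copies), and the Hecke relation in the form of capelli_shiftS.
    The reflection equation for M plays no role.

    Under the R-trace the operators x_i become scalars.  The R-trace is cyclic
    with respect to the R_i, because R commutes with C (x) C (tens_C_comm,
    which is deduced from R^-1 C_2 = C_1 Psi_21 and its transpose).  As x_i
    commutes with everything to the right of it in the product, it can be
    moved to the right end and around the trace to the projector A, on which
    J_i acts as q^(2(i-1)) and hence x_i as q^(i-1) (i-1)_q
    (tr_shift_scalar).  The same cyclicity turns J_1 ... J_k into
    q^(k(k-1)).  That R_i A^(k) = - q^-1 A^(k) for i < k is skew_spec.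

    The symmetric identity is the antisymmetric one for the parameter - q^-1:
    a Hecke symmetry for q is also one for - q^-1, and the symmetrizer for q is
    the skew-symmetrizer for - q^-1 (symmetrizerE). *)

(** * Copies of a braid group action and the universal Capelli identity *)

Section BraidedCopies.
(* r i and ri i stand for R_i and its inverse, acting in n + 1 tensor factors;
   nothing is assumed about them outside 1 <= i <= n. *)
Variables (B : pzRingType) (n : nat) (r ri : nat -> B).
Hypothesis rK : forall i, (0 < i <= n)%N -> r i * ri i = 1.
Hypothesis riK : forall i, (0 < i <= n)%N -> ri i * r i = 1.
Hypothesis braid : forall i, (0 < i < n)%N ->
  r i * r i.+1 * r i = r i.+1 * r i * r i.+1.
Hypothesis far : forall i j, (0 < i)%N -> (i.+1 < j <= n)%N ->
  GRing.comm (r i) (r j).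

Lemma comm_inv z i : (0 < i <= n)%N -> GRing.comm z (r i) -> GRing.comm z (ri i).
Proof.
move=> hi cz; rewrite /GRing.comm -[LHS]mul1r -(riK hi) -mulrA.
by rewrite (mulrA (r i)) -cz -!mulrA rK // mulr1.
Qed.

(** The copies X_1 = X, X_(i+1) = R_i X_i R_i^-1 of an element X; index 0 is a
    junk value equal to X. *)
Fixpoint copies (X : B) (i : nat) : B :=
  if i is (h.+1 as p).+1 then r p * copies X p * ri p else X.

Lemma copiesS X i : (0 < i)%N -> copies X i.+1 = r i * copies X i * ri i.
Proof. by case: i. Qed.

Lemma braid_mixed i : (0 < i < n)%N -> r i * r i.+1 * ri i = ri i.+1 * r i * r i.+1.
Proof.
move=> hi.
have h1 : (0 < i <= n)%N by case/andP: hi => -> /ltnW.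
have h2 : (0 < i.+1 <= n)%N by case/andP: hi.
rewrite -[LHS]mul1r -(riK h2) -[RHS]mulr1 -(rK h1) -!mulrA; congr (_ * _).
by rewrite !mulrA -braid // -!mulrA.
Qed.

Section Copies.
Variable X : B.
Hypothesis comm1 : forall i, (1 < i <= n)%N -> GRing.comm (r i) X.

Lemma copies_comm_gt i j : (0 < i < j)%N -> (j <= n)%N ->
  GRing.comm (r j) (copies X i).
Proof.
elim: i => [|[|i] IH] // /andP[_ lij] hj; first by apply: comm1; rewrite lij.
have c1 : GRing.comm (r j) (r i.+1) by apply/commr_sym/far; rewrite // lij.
rewrite copiesS //; apply: commrM; last first.
  by apply: comm_inv => //; rewrite ltnS /= (leq_trans _ hj) // ltnW // ltnW.
by apply: commrM => //; apply: IH => //; rewrite /= ltnW.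
Qed.

(** The element R_i R_(i+1), conjugation by which sends R_i to R_(i+1) and the
    i-th copy of X to the next one.  It transports relations that hold at level 1
    to every level. *)
Definition braid_shift i := r i * r i.+1.

Lemma braid_shift_r i : (0 < i < n)%N -> braid_shift i * r i = r i.+1 * braid_shift i.
Proof. by move=> hi; rewrite /braid_shift braid // mulrA. Qed.

Lemma braid_shift_ri i : (0 < i < n)%N -> braid_shift i * ri i = ri i.+1 * braid_shift i.
Proof. by move=> hi; rewrite /braid_shift braid_mixed // mulrA. Qed.

Lemma braid_shift_copies i : (0 < i < n)%N ->
  braid_shift i * copies X i = copies X i.+1 * braid_shift i.
Proof.
move=> hi; case/andP: (hi) => i0 ltin.
rewrite copiesS // /braid_shift -!mulrA (mulrA (ri i)) riK ?i0 1?ltnW // mul1r.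
by rewrite copies_comm_gt ?i0 ?leqnn.
Qed.

Lemma braid_shift_inj i x y : (0 < i < n)%N -> x * braid_shift i = y * braid_shift i -> x = y.
Proof.
move=> /andP[i0 ltin] /(congr1 (fun z => z * (ri i.+1 * ri i))).
rewrite -!(mulrA _ (braid_shift i)).
have -> : braid_shift i * (ri i.+1 * ri i) = 1.
  by rewrite /braid_shift mulrA -(mulrA (r i)) rK // mulr1 rK // i0 ltnW.
by rewrite !mulr1.
Qed.

Lemma copies_comm_lt i j : (0 < j)%N -> (j.+1 < i <= n.+1)%N ->
  GRing.comm (r j) (copies X i).
Proof.
move=> j0; elim: i => // i IH /andP[]; rewrite ltnS leq_eqVlt ltnS => /orP[/eqP<- hj|lt hi].
  have hjn : (0 < j < n)%N by rewrite j0.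
  have hj1 : (0 < j <= n)%N by rewrite j0 ltnW.
  have e : ri j * ri j.+1 * r j = r j.+1 * ri j * ri j.+1.
    transitivity (ri j * (ri j.+1 * r j * r j.+1) * ri j.+1).
      by rewrite -!mulrA rK // mulr1.
    by rewrite -braid_mixed // !mulrA riK // mul1r.
  rewrite !copiesS // /GRing.comm -!mulrA (mulrA (ri j)) e !mulrA braid //.
  by rewrite -!mulrA; do 2 congr (_ * _); rewrite !mulrA copies_comm_gt ?j0 ?leqnn.
have i0 : (0 < i)%N by apply: leq_trans lt.
have cji : GRing.comm (r j) (r i) by apply: far; rewrite // lt.
rewrite copiesS //; apply: commrM; last by apply: comm_inv; rewrite // i0.
by apply: commrM => //; apply: IH; rewrite lt ltnW.
Qed.
End Copies.

Variables (M1 D1 : B).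
Hypothesis commM : forall i, (1 < i <= n)%N -> GRing.comm (r i) M1.
Hypothesis commD : forall i, (1 < i <= n)%N -> GRing.comm (r i) D1.
Hypothesis DD : (0 < n)%N ->
  ri 1 * D1 * ri 1 * D1 = D1 * ri 1 * D1 * ri 1.
Hypothesis DM : (0 < n)%N ->
  D1 * r 1 * M1 = r 1 * M1 * ri 1 * D1 * ri 1 + 1.

Local Notation M := (copies M1).
Local Notation D := (copies D1).
Local Notation L := (copies (M1 * D1)).

Lemma intertwineM (u x x' y y' : B) :
  u * x = x' * u -> u * y = y' * u -> u * (x * y) = (x' * y') * u.
Proof. by move=> ex ey; rewrite mulrA ex -!mulrA ey. Qed.

Lemma copiesDD i : (0 < i <= n)%N ->
  ri i * D i * ri i * D i = D i * ri i * D i * ri i.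
Proof.
elim: i => // -[|i] IH /andP[_ hi]; first exact: DD.
have hin : (0 < i.+1 < n)%N by [].
have hi1 : (0 < i.+1 <= n)%N by exact: ltnW.
have sD := braid_shift_copies commD hin; have sr := braid_shift_ri hin.
have e1 := intertwineM (intertwineM (intertwineM sr sD) sr) sD.
have e2 := intertwineM (intertwineM (intertwineM sD sr) sD) sr.
by apply: (braid_shift_inj hin); rewrite -e1 -e2 IH.
Qed.

Lemma copiesDM i : (0 < i <= n)%N ->
  D i * r i * M i = r i * M i * ri i * D i * ri i + 1.
Proof.
elim: i => // -[|i] IH /andP[_ hi]; first exact: DM.
have hin : (0 < i.+1 < n)%N by [].
have hi1 : (0 < i.+1 <= n)%N by exact: ltnW.
have sD := braid_shift_copies commD hin; have sM := braid_shift_copies commM hin.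
have sr := braid_shift_ri hin; have s := braid_shift_r hin.
have e1 := intertwineM (intertwineM sD s) sM.
have e2 := intertwineM (intertwineM (intertwineM (intertwineM s sM) sr) sD) sr.
apply: (braid_shift_inj hin); rewrite mulrDl mul1r.
by rewrite -e1 -e2 IH ?mulrDr ?mulr1.
Qed.

(* Here lam stands for q - q^-1, lami for its inverse, and mu for - q, the
   eigenvalue of the R_i^-1 on the projector.  They are taken as
   central elements, so that B is only assumed to be a ring, possibly trivial. *)
Variables lam lami mu : B.
Hypothesis lamC : forall z, GRing.comm lam z.
Hypothesis lamiC : forall z, GRing.comm lami z.
Hypothesis muC : forall z, GRing.comm mu z.
Hypothesis lamK : lami * lam = 1.
Hypothesis hecke : forall i, (0 < i <= n)%N -> r i = ri i + lam.

(** The inverse Jucys-Murphy elements: J_1 = 1, J_(i+1) = R_i^-1 J_i R_i^-1;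
    index 0 is a junk value. *)
Fixpoint jucys (i : nat) : B :=
  if i is (h.+1 as p).+1 then ri p * jucys p * ri p else 1.

(** The operator-valued shift x_i = (J_i - 1) / lam. *)
Definition capelli_shift i := lami * (jucys i - 1).

Local Notation J := jucys.
Local Notation x := capelli_shift.

Lemma jucysS i : (0 < i)%N -> J i.+1 = ri i * J i * ri i.
Proof. by case: i. Qed.

(** The descending product D_k ... D_1. *)
Definition desc_prod (k : nat) : B := \prod_(1 <= j < k.+1) D (k.+1 - j).

Lemma descS k : desc_prod k.+1 = D k.+1 * desc_prod k.
Proof.
rewrite /desc_prod big_ltn // subSS subn0; congr (_ * _).
by rewrite big_add1; apply: eq_bigr => j _; rewrite subSS.
Qed.

Lemma desc_comm k j : (k < j <= n)%N -> GRing.comm (r j) (desc_prod k).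
Proof.
elim: k => [|k IH] /andP[lkj hj]; first by rewrite /desc_prod big_geq //; apply: commr1.
rewrite descS; apply: commrM; first exact: copies_comm_gt.
by apply: IH; rewrite ltnW.
Qed.

(** The Hecke relation, written for R_i^-1. *)
Lemma hecke_sqr i : (0 < i <= n)%N -> ri i * ri i + lam * ri i = 1.
Proof. by move=> hi; rewrite -mulrDl -hecke // rK. Qed.

(** A recursion for x_i which, unlike that for J_i, involves R_i on the left
    and R_i^-1 on the right, like the one for the copies of L. *)
Lemma capelli_shiftS i : (0 < i <= n)%N ->
  r i * x i * ri i - J i * ri i = x i.+1.
Proof.
move=> hi; rewrite /x jucysS; last by case/andP: hi.
have -> : r i * (lami * (J i - 1)) = lami * (ri i * (J i - 1)) + (J i - 1).
  by rewrite hecke // mulrDl !mulrA -lamiC lamC lamK mul1r.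
rewrite mulrDl [X in _ + X - _]mulrBl mul1r addrA addrAC addrK.
have e : lami * (ri i * ri i) = lami - ri i.
  apply/eqP; rewrite -subr_eq opprK; apply/eqP.
  by rewrite -[X in _ + X = _]mul1r -lamK -mulrA -mulrDr hecke_sqr ?mulr1.
rewrite -(mulrA lami) [ri i * (_ - 1)]mulrBr mulr1 (mulrBl _ _ (ri i)).
by rewrite !(mulrBr lami) e mulr1 opprB addrA addrAC addrK.
Qed.

(** The inductive step of the universal Capelli identity: multiplying the
    descending product of derivatives by the shifted copy of L produces no
    lower-order terms. *)
Lemma desc_L k : (k <= n)%N ->
  desc_prod k * (L k.+1 + x k.+1) = M k.+1 * D k.+1 * desc_prod k * J k.+1.
Proof.
elim: k => [|k IH] hk.
  by rewrite /desc_prod big_geq // /x subrr mulr0 addr0 mul1r !mulr1.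
have hk1 : (0 < k.+1 <= n)%N by [].
have cT : desc_prod k * r k.+1 = r k.+1 * desc_prod k by rewrite -desc_comm ?ltnSn.
have cTi : desc_prod k * ri k.+1 = ri k.+1 * desc_prod k.
  by rewrite (comm_inv (z := desc_prod k)) //; apply/commr_sym/desc_comm; rewrite ltnSn.
have IH' : desc_prod k * L k.+1 =
    M k.+1 * D k.+1 * desc_prod k * J k.+1 - desc_prod k * x k.+1.
  by rewrite -IH 1?ltnW // mulrDr addrK.
have dbd : D k.+1 * ri k.+1 * D k.+1 = D k.+2 * D k.+1 * ri k.+1.
  transitivity (r k.+1 * (D k.+1 * ri k.+1 * D k.+1 * ri k.+1)).
    by rewrite -copiesDD // !mulrA rK // mul1r.
  by rewrite (copiesS D1 (ltn0Sn k)) !mulrA.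
rewrite mulrDr (copiesS _ (ltn0Sn k)) descS.
transitivity (D k.+1 * r k.+1 * (desc_prod k * L k.+1) * ri k.+1
    + D k.+1 * desc_prod k * x k.+2).
  by rewrite -!mulrA (mulrA (desc_prod k)) cT !mulrA.
rewrite IH' -(capelli_shiftS hk1) (jucysS (ltn0Sn k)) (copiesS M1 (ltn0Sn k)).
set a := r _; set b := ri _; set d := D k.+1; set T := desc_prod k.
set m := M _; set d' := D _; set X := x _; set j := J _.
have hDM : d * a * m = a * m * b * d * b + 1 by apply: copiesDM.
have e1 : d * a * (m * d * T * j - T * X) * b =
    a * m * (b * (d * b * d) * T * j * b) + d * T * (j * b) - d * T * (a * X * b).
  (* only here is the permutation relation between D and M used *)
  rewrite mulrBr mulrBl; congr (_ - _).
    transitivity (d * a * m * (d * T * j * b)); first by rewrite !mulrA.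
    by rewrite hDM mulrDl mul1r !mulrA.
  by rewrite -(mulrA d a) (mulrA a T) -cT !mulrA.
rewrite e1 dbd mulrBr addrA subrK addrK.
by rewrite -!mulrA (mulrA b T) -cTi -!mulrA.
Qed.

Lemma braid_inv i : (0 < i < n)%N ->
  ri i * ri i.+1 * ri i = ri i.+1 * ri i * ri i.+1.
Proof.
move=> hi; case/andP: (hi) => i0 ltin.
have h1 : (0 < i <= n)%N by rewrite i0 ltnW.
have h2 : (0 < i.+1 <= n)%N by [].
have e : r i.+1 * r i * r i.+1 * (ri i.+1 * ri i * ri i.+1) = 1.
  rewrite !mulrA -(mulrA _ (r i.+1)) rK // mulr1.
  by rewrite -(mulrA _ (r i)) rK // mulr1 rK.
have e' : ri i * ri i.+1 * ri i * (r i * r i.+1 * r i) = 1.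
  rewrite !mulrA -(mulrA _ (ri i)) riK // mulr1.
  by rewrite -(mulrA _ (ri i.+1)) riK // mulr1 riK.
by rewrite -[LHS]mulr1 -e -braid // mulrA e' mul1r.
Qed.

Lemma comm_jucys z i : (i <= n.+1)%N ->
  (forall j, (0 < j < i)%N -> GRing.comm z (r j)) -> GRing.comm z (J i).
Proof.
elim: i => [|[|i] IH] hi cz; [exact: commr1|exact: commr1|].
have ci : GRing.comm z (ri i.+1) by apply: comm_inv => //; apply: cz => /=.
rewrite jucysS //; apply: commrM => //; apply: commrM => //.
by apply: IH; [exact: ltnW|move=> j /andP[j0 hj]; apply: cz; rewrite j0 ltnW].
Qed.

(** J_j commutes with R_1, ..., R_(j-2). *)
Lemma r_jucys i j : (0 < i)%N -> (i.+1 < j <= n.+1)%N -> GRing.comm (r i) (J j).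
Proof.
move=> i0; elim: j => // j IH /andP[]; rewrite ltnS leq_eqVlt ltnS => /orP[/eqP<- hi|lt hj].
  have hin : (0 < i < n)%N by rewrite i0.
  have h1 : (0 < i <= n)%N by rewrite i0 ltnW.
  have cb : GRing.comm (ri i.+1) (J i).
    apply: comm_jucys => [|k /andP[k0 ki]]; first by rewrite ltnW // ltnW // ltnS ltnW.
    by apply: commr_sym; apply: comm_inv => //; apply: far; rewrite ?k0 // ltnS ki.
  apply: commr_sym; rewrite [r i]hecke //; apply: commrD; last exact/commr_sym/lamC.
  have ca := braid_inv hin.
  rewrite !jucysS // /GRing.comm; set a := ri i in ca *; set b := ri _ in ca cb *.
  transitivity (b * a * J i * (b * a * b)); first by rewrite -ca !mulrA.
  transitivity (b * a * b * J i * a * b); last by rewrite -ca !mulrA.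
  by rewrite !mulrA -(mulrA (b * a) (J i)) -cb !mulrA.
have j0 : (0 < j)%N by apply: leq_trans lt.
have cij : GRing.comm (r i) (ri j) by apply: comm_inv; [rewrite j0|apply: far; rewrite ?lt].
rewrite jucysS //; apply: commrM => //; apply: commrM => //.
by apply: IH; rewrite lt ltnW.
Qed.

Lemma comm_capelli_shift z i : GRing.comm z (J i) -> GRing.comm z (x i).
Proof.
move=> c; apply: commrM; first exact/commr_sym/lamiC.
by apply: commrB => //; apply: commr1.
Qed.

Lemma comm_L i j : (0 < j)%N -> (j.+1 < i <= n.+1)%N -> GRing.comm (r j) (L i).
Proof.
move=> j0 hij; apply: copies_comm_lt => // k hk.
by apply: commrM; [exact: commM|exact: commD].
Qed.

Lemma prodS (F : nat -> B) k :
  \prod_(1 <= j < k.+2) F j = \prod_(1 <= j < k.+1) F j * F k.+1.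
Proof. by rewrite big_nat_recr. Qed.

(** The universal Capelli identity, valid before any trace is taken. *)
Lemma universal_capelli k : (k <= n.+1)%N ->
  \prod_(1 <= j < k.+1) (L j + x j) =
  (\prod_(1 <= j < k.+1) M j) * desc_prod k * \prod_(1 <= j < k.+1) J j.
Proof.
elim: k => [|k IH] hk; first by rewrite /desc_prod !big_geq // !mulr1.
rewrite prodS IH 1?ltnW //.
have cJ : GRing.comm (L k.+1 + x k.+1) (\prod_(1 <= j < k.+1) J j).
  rewrite big_nat; apply: commr_prod => i /andP[i0 ik].
  apply: comm_jucys => [|j /andP[j0 ji]]; first by rewrite ltnW // (leq_trans ik) // ltnW.
  have hj : (j.+1 < k.+1 <= n.+1)%N by rewrite hk andbT (leq_ltn_trans ji).
  apply: commr_sym; apply: commrD; first exact: comm_L.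
  by apply/comm_capelli_shift/r_jucys.
have cJJ : GRing.comm (J k.+1) (\prod_(1 <= j < k.+1) J j).
  rewrite big_nat; apply: commr_prod => i /andP[i0 ik].
  apply: comm_jucys => [|j /andP[j0 ji]]; first by rewrite ltnW // (leq_trans ik) // ltnW.
  apply: commr_sym; apply: r_jucys => //.
  by rewrite hk andbT (leq_ltn_trans ji).
rewrite -mulrA -cJ mulrA -(mulrA _ (desc_prod k)) desc_L //.
by rewrite descS (prodS M) (prodS J) !mulrA -!(mulrA _ (J k.+1)) cJJ !mulrA.
Qed.

Section Trace.
Variables (C : zmodType) (tr : {additive B -> C}) (A : B).
Hypothesis tr_r : forall i z, (0 < i <= n)%N -> tr (r i * z) = tr (z * r i).
Hypothesis riA : forall i, (0 < i <= n)%N -> ri i * A = mu * A.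

(** Cyclicity of tr with respect to a single element. *)
Definition cyclic w := forall z, tr (w * z) = tr (z * w).

Lemma cyclicM v w : cyclic v -> cyclic w -> cyclic (v * w).
Proof. by move=> cv cw z; rewrite -mulrA cv -mulrA cw mulrA. Qed.

Lemma cyclicB v w : cyclic v -> cyclic w -> cyclic (v - w).
Proof. by move=> cv cw z; rewrite mulrBl mulrBr !raddfB cv cw. Qed.

Lemma cyclic_central v : (forall z, GRing.comm v z) -> cyclic v.
Proof. by move=> cv z; rewrite cv. Qed.

Lemma cyclic_ri i : (0 < i <= n)%N -> cyclic (ri i).
Proof.
move=> hi; have -> : ri i = r i - lam by rewrite hecke // addrK.
by apply: cyclicB; [move=> z; apply: tr_r|apply: cyclic_central].
Qed.

Lemma cyclic_jucys i : (i <= n.+1)%N -> cyclic (J i).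
Proof.
elim: i => [|[|i] IH] hi; [by move=> z; rewrite mul1r mulr1..|].
rewrite jucysS //; apply: cyclicM; last exact: cyclic_ri.
by apply: cyclicM; [exact: cyclic_ri|apply: IH; apply: ltnW].
Qed.

Lemma cyclic_capelli_shift i : (i <= n.+1)%N -> cyclic (x i).
Proof.
move=> hi; apply: cyclicM; first exact: cyclic_central.
by apply: cyclicB; [exact: cyclic_jucys|move=> z; rewrite mul1r mulr1].
Qed.

Lemma jucysA i : (0 < i <= n.+1)%N -> J i * A = mu ^+ i.-1.*2 * A.
Proof.
elim: i => // -[|i] IH /andP[_ hi]; first by rewrite expr0.
have cX z k : z * mu ^+ k = mu ^+ k * z by apply: commrX; apply/commr_sym/muC.
transitivity (mu * mu ^+ i.*2 * mu * A).
  rewrite jucysS // -mulrA riA // (mulrA _ mu) -muC -!mulrA IH; last exact: ltnW.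
  by rewrite /= (mulrA (ri _)) cX -(mulrA _ _ A) riA // !mulrA.
by congr (_ * _); rewrite -mulrA -(exprSr mu i.*2) -(exprS mu (i.*2).+1).
Qed.

(** The scalar by which x_i acts on A. *)
Definition capelli_scalar i := lami * (mu ^+ i.-1.*2 - 1).

Lemma capelli_shiftA i : (0 < i <= n.+1)%N -> x i * A = capelli_scalar i * A.
Proof. by move=> hi; rewrite /x /capelli_scalar -!(mulrA lami) !mulrBl jucysA. Qed.

Lemma capelli_scalarC i z : GRing.comm (capelli_scalar i) z.
Proof.
apply: commr_sym; apply: commrM; first exact/commr_sym/lamiC.
by apply: commrB; [exact/commrX/commr_sym/muC|exact: commr1].
Qed.

(** Under tr the shifts x_j may be replaced with scalars.  The product of the
    factors that follow the m-th one is y: it commutes with R_1, ..., R_(m-1),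
    so that x_m can be moved past it and around the trace to A. *)
Lemma tr_shift_scalar m y : (m <= n.+1)%N ->
  (forall i, (0 < i < m)%N -> GRing.comm (r i) y) ->
  tr (A * \prod_(1 <= j < m.+1) (L j + x j) * y) =
  tr (A * \prod_(1 <= j < m.+1) (L j + capelli_scalar j) * y).
Proof.
elim: m y => [|m IH] y hm cy; first by rewrite !big_geq.
rewrite !prodS !mulrA -!(mulrA _ _ y).
have cLx i : (0 < i < m)%N -> GRing.comm (r i) (L m.+1 + x m.+1).
  move=> /andP[i0 im]; have him : (i.+1 < m.+1 <= n.+1)%N by rewrite ltnS im.
  by apply: commrD; [exact: comm_L|exact/comm_capelli_shift/r_jucys].
rewrite IH; last 2 first.
- exact: ltnW.
- move=> i him; apply: commrM; first exact: cLx.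
  by case/andP: him => i0 im; apply: cy; rewrite i0 ltnW.
rewrite !mulrDl !mulrDr !raddfD; congr (_ + _).
set P := \prod_(_ <= _ < _) _.
have -> : x m.+1 * y = y * x m.+1.
  apply: commr_sym; apply: comm_capelli_shift; apply: comm_jucys => // i hi.
  exact/commr_sym/cy.
rewrite mulrA -(cyclic_capelli_shift hm) -(mulrA A P) mulrA capelli_shiftA //.
by rewrite (mulrA (A * P)) -(capelli_scalarC _ (A * P)) !mulrA.
Qed.

Lemma prod_jucysA k : (k <= n.+1)%N ->
  (\prod_(1 <= j < k.+1) J j) * A = mu ^+ (k * k.-1) * A.
Proof.
elim: k => [|k IH] hk; first by rewrite big_geq // expr0.
have cX z e : z * mu ^+ e = mu ^+ e * z by apply: commrX; apply/commr_sym/muC.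
rewrite prodS -mulrA jucysA // mulrA cX -mulrA IH; last exact: ltnW.
rewrite mulrA -exprD; congr (mu ^+ _ * _).
by case: k {IH hk} => //= k; rewrite -muln2 -mulnDr mulnC.
Qed.

(** The traced Capelli identity for an element A on which all R_i^-1 act as mu. *)
Theorem capelli_tr :
  tr (A * \prod_(1 <= j < n.+2) (L j + capelli_scalar j)) =
  tr (mu ^+ (n.+1 * n) * (A * ((\prod_(1 <= j < n.+2) M j) * desc_prod n.+1))).
Proof.
rewrite -[A * _ in LHS]mulr1 -tr_shift_scalar //; last first.
  by move=> i hi; apply: commr1.
rewrite mulr1 universal_capelli // mulrA.
have c k : (k <= n.+1)%N -> cyclic (\prod_(1 <= j < k.+1) J j).
  elim: k => [|k IH] hk; first by rewrite big_geq // => z; rewrite mul1r mulr1.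
  by rewrite prodS; apply: cyclicM; [apply: IH; apply: ltnW|exact: cyclic_jucys].
by rewrite -c // mulrA prod_jucysA // -mulrA.
Qed.
End Trace.
End BraidedCopies.

(** * Operators acting in one or two tensor factors *)

Section Local.
Variables (B : pzRingType) (N k : nat).
Local Notation state := {ffun 'I_k -> 'I_N}.
Implicit Types (X Y Z : 'T[B]_(N, k)) (a b c : state) (p : 'I_k).

(** The matrix entries of an operator on the k-fold tensor power, indexed by
    multi-indices. *)
Definition entry X a b : B := X (enum_rank a) (enum_rank b).

Lemma entry_tens E a b : entry (tens_mx E) a b = E a b.
Proof. by rewrite /entry mxE !enum_rankK. Qed.

Lemma entryP X Y : (forall a b, entry X a b = entry Y a b) -> X = Y.
Proof.
by move=> e; apply/matrixP=> s t; rewrite -(enum_valK s) -(enum_valK t); apply: e.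
Qed.

Lemma entryM X Y a b : entry (X *m Y) a b = \sum_c entry X a c * entry Y c b.
Proof.
rewrite /entry mxE (reindex (fun c : state => enum_rank c)) //.
by exists enum_val => i _; rewrite (enum_rankK, enum_valK).
Qed.

Lemma sum_mxtens (V : nmodType) (f : 'I_(N * N) -> V) :
  \sum_s f s = \sum_x \sum_y f (mxtens_index (x, y)).
Proof.
rewrite pair_bigA /= (reindex (fun z => mxtens_index (m := N) (n := N) z)) /=.
  by apply: eq_bigr => -[].
by exists (@mxtens_unindex N N) => i _; rewrite (mxtens_indexK, mxtens_unindexK).
Qed.

(** Multi-indices that coincide except possibly at p and p'. *)
Definition agree_off2 p p' a b := [forall l, (l != p) && (l != p') ==> (a l == b l)].

(** X acting in the tensor factors p and p', in this order.  The operator at2 is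
    the special case of two consecutive factors. *)
Definition loc2 p p' (X : 'M[B]_(N * N)) : 'T[B]_(N, k) :=
  tens_mx (fun a b => X (mxtens_index (a p, a p')) (mxtens_index (b p, b p'))
     *+ agree_off2 p p' a b).

(** X acting in the tensor factor p; at1 is a special case. *)
Definition loc1 p (X : 'M[B]_N) : 'T[B]_(N, k) :=
  tens_mx (fun a b => X (a p) (b p) *+ [forall l, (l != p) ==> (a l == b l)]).

(** The multi-index a with its components at p and p' replaced with x and y. *)
Definition upd2 p p' a x y : state :=
  [ffun l => if l == p then x else if l == p' then y else a l].

Lemma agree_upd2 p p' a x y b : agree_off2 p p' (upd2 p p' a x y) b = agree_off2 p p' a b.
Proof.
by apply: eq_forallb => l; rewrite ffunE; case: (l == p); case: (l == p').
Qed.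

Section Pair.
Variables (p p' : 'I_k).
Hypothesis pp' : p != p'.

Lemma upd2_1 a x y : upd2 p p' a x y p = x.
Proof. by rewrite ffunE eqxx. Qed.

Lemma upd2_2 a x y : upd2 p p' a x y p' = y.
Proof. by rewrite ffunE eq_sym (negbTE pp') eqxx. Qed.

Lemma entry_loc2M (X : 'M[B]_(N * N)) Y a b :
  entry (loc2 p p' X *m Y) a b =
  \sum_x \sum_y X (mxtens_index (a p, a p')) (mxtens_index (x, y))
     * entry Y (upd2 p p' a x y) b.
Proof.
rewrite entryM (bigID (agree_off2 p p' a)) /= [X in _ + X]big1 ?addr0; last first.
  by move=> c /negbTE h; rewrite entry_tens h mulr0n mul0r.
rewrite pair_bigA /=.
rewrite (reindex_onto (fun z => upd2 p p' a z.1 z.2) (fun c => (c p, c p'))) /=.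
  apply: eq_big => [[x y]|[x y] _] /=.
    rewrite upd2_1 upd2_2 eqxx andbT; apply/forallP=> l; apply/implyP.
    by rewrite ffunE => /andP[/negbTE-> /negbTE->].
  rewrite entry_tens upd2_1 upd2_2.
  suff -> : agree_off2 p p' a (upd2 p p' a x y) by rewrite mulr1n.
  by apply/forallP=> l; apply/implyP; rewrite ffunE => /andP[/negbTE-> /negbTE->].
move=> c /forallP h; apply/ffunP=> l; rewrite ffunE.
case: eqP => [->//|/eqP h1]; case: eqP => [->//|/eqP h2].
by apply/eqP; apply: (implyP (h l)); rewrite h1.
Qed.

Lemma loc2M (X Y : 'M[B]_(N * N)) : loc2 p p' (X *m Y) = loc2 p p' X *m loc2 p p' Y.
Proof.
apply: entryP => a b; rewrite entry_loc2M entry_tens mxE sum_mxtens -sumrMnl.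
apply: eq_bigr => x _; rewrite -sumrMnl; apply: eq_bigr => y _.
by rewrite entry_tens upd2_1 upd2_2 agree_upd2 mulrnAr.
Qed.

Lemma mxtens_index_eq (x y x' y' : 'I_N) :
  (mxtens_index (x, y) == mxtens_index (x', y')) = (x == x') && (y == y').
Proof. by rewrite (inj_eq (can_inj (@mxtens_indexK _ _))) xpair_eqE. Qed.

Lemma loc2_scalar (c : B) : loc2 p p' c%:M = c%:M.
Proof.
apply: entryP => a b; rewrite entry_tens /entry !mxE (inj_eq enum_rank_inj) -mulrnA.
rewrite mxtens_index_eq mulnb; congr (_ *+ nat_of_bool _).
apply/andP/eqP => [[/andP[/eqP e1 /eqP e2] /forallP h]|->]; last first.
  by rewrite !eqxx; split=> //; apply/forallP=> l; rewrite eqxx implybT.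
apply/ffunP=> l; case: (eqVneq l p) => [->//|h1]; case: (eqVneq l p') => [->//|h2].
by apply/eqP; apply: (implyP (h l)); rewrite h1.
Qed.

Lemma loc2D (X Y : 'M[B]_(N * N)) : loc2 p p' (X + Y) = loc2 p p' X + loc2 p p' Y.
Proof. by apply/matrixP=> s t; rewrite !mxE mulrnDl. Qed.

Lemma loc2_left (X : 'M[B]_N) : loc2 p p' (X *t 1%:M) = loc1 p X.
Proof.
apply: entryP => a b; rewrite !entry_tens tensmxE mxE mulr_natr -mulrnA mulnb.
congr (_ *+ nat_of_bool _); apply/andP/forallP => [[/eqP e /forallP h] l|h].
  apply/implyP=> h1; case: (eqVneq l p') => [->|h2]; first by rewrite e.
  by apply: (implyP (h l)); rewrite h1.
split; first by apply: (implyP (h p')); rewrite eq_sym.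
by apply/forallP=> l; apply/implyP => /andP[h1 _]; apply: (implyP (h l)).
Qed.

Lemma loc2_right (X : 'M[B]_N) : loc2 p p' (1%:M *t X) = loc1 p' X.
Proof.
apply: entryP => a b; rewrite !entry_tens tensmxE mxE mulr_natl -mulrnA mulnb.
congr (_ *+ nat_of_bool _); apply/andP/forallP => [[/eqP e /forallP h] l|h].
  apply/implyP=> h1; case: (eqVneq l p) => [->|h2]; first by rewrite e.
  by apply: (implyP (h l)); rewrite h2.
split; first by apply: (implyP (h p)).
by apply/forallP=> l; apply/implyP => /andP[_ h1]; apply: (implyP (h l)).
Qed.
End Pair.

(** X acts only in the tensor factors whose position satisfies P: it is diagonal
    in the other ones, and does not depend on the indices there. *)
Definition supported (P : pred 'I_k) X :=
  (forall a b l, ~~ P l -> a l != b l -> entry X a b = 0) /\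
  (forall a b a' b', (forall l, P l -> a l = a' l /\ b l = b' l) ->
     (forall l, ~~ P l -> a l = b l /\ a' l = b' l) ->
     entry X a b = entry X a' b').

Lemma supported_loc1 p (X : 'M[B]_N) : supported (pred1 p) (loc1 p X).
Proof.
split=> [a b l /= lp ab|a b a' b' h h']; rewrite !entry_tens.
  rewrite (_ : [forall _, _] = false) //; apply/negbTE/forallPn; exists l.
  by rewrite lp.
have [-> ->] := h p (eqxx p); congr (_ *+ nat_of_bool _).
by apply: eq_forallb => l; case: (boolP (l == p)) => //= /h' [-> ->]; rewrite !eqxx.
Qed.

Lemma supported_loc2 p p' (X : 'M[B]_(N * N)) : supported (pred2 p p') (loc2 p p' X).
Proof.
split=> [a b l /= lp ab|a b a' b' h h']; rewrite !entry_tens.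
  rewrite (_ : agree_off2 _ _ _ _ = false) //; apply/negbTE/forallPn; exists l.
  by rewrite -negb_or lp.
have [|-> ->] := h p; first by rewrite /= eqxx.
have [|-> ->] := h p'; first by rewrite /= eqxx orbT.
congr (_ *+ nat_of_bool _).
apply: eq_forallb => l; rewrite -negb_or.
by case: (boolP (_ || _)) => //= /h' [-> ->]; rewrite !eqxx.
Qed.

(** The multi-index equal to b at the positions satisfying P, and to a elsewhere. *)
Definition mix (P : pred 'I_k) a b : state := [ffun l => if P l then b l else a l].

(** Only one term survives in each entry of a product of operators with
    disjoint supports. *)
Lemma supported_mul (P Q : pred 'I_k) X Y a b :
  supported P X -> supported Q Y -> (forall l, P l -> ~~ Q l) ->
  entry (X *m Y) a b = entry X a (mix P a b) * entry Y (mix P a b) b.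
Proof.
move=> [X0 _] [Y0 _] PQ; rewrite entryM (bigD1 (mix P a b)) //= big1 ?addr0 // => c nc.
have [l ncl] : exists l, c l != mix P a b l.
  apply/existsP; apply: contraNT nc => /existsPn h; apply/eqP/ffunP=> l.
  by have /negPn/eqP := h l.
move: ncl; rewrite ffunE; case: (boolP (P l)) => hl ncl.
  by rewrite (Y0 c b l) ?mulr0 // PQ.
by rewrite (X0 a c l) ?mul0r // eq_sym.
Qed.

(** Operators with disjoint supports commute, provided that their entries do. *)
Lemma supported_comm (P Q : pred 'I_k) X Y :
  supported P X -> supported Q Y -> (forall l, P l -> ~~ Q l) ->
  (forall s t s' t', GRing.comm (X s t) (Y s' t')) ->
  X *m Y = Y *m X.
Proof.
move=> sX sY PQ XY; have QP l : Q l -> ~~ P l.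
  by move=> hQ; apply/negP => /PQ; rewrite hQ.
apply: entryP => a b; rewrite (supported_mul a b sX sY PQ) (supported_mul a b sY sX QP).
case: sX sY => [X0 X1] [Y0 Y1].
case: (boolP [exists l, [&& ~~ P l, ~~ Q l & a l != b l]]).
  case/existsP=> l /and3P[nP nQ nab].
  rewrite (Y0 (mix P a b) b l) ?ffunE ?(negbTE nP) // (X0 (mix Q a b) b l).
  - by rewrite !mulr0.
  - by [].
  by rewrite ffunE (negbTE nQ).
move/existsPn=> h.
have ab l : ~~ P l -> ~~ Q l -> a l = b l.
  by move=> nP nQ; have := h l; rewrite nP nQ /= => /negPn/eqP.
rewrite (X1 a (mix P a b) (mix Q a b) b); last first.
- by move=> l nP; rewrite !ffunE (negbTE nP); case: ifP => // /negbT /(ab l nP).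
- by move=> l hP; rewrite !ffunE hP (negbTE (PQ l hP)).
rewrite (Y1 (mix P a b) b a (mix Q a b)); first exact: XY.
- by move=> l hQ; rewrite !ffunE hQ (negbTE (QP l hQ)).
by move=> l nQ; rewrite !ffunE (negbTE nQ); case: ifP => // /negbT nP; rewrite ab.
Qed.
End Local.

Section Local1.
Variables (B : pzRingType) (N k : nat) (p : 'I_k).

Lemma loc1M (X Y : 'M[B]_N) : loc1 p (X *m Y) = loc1 p X *m loc1 p Y.
Proof.
apply: entryP => a b; rewrite entryM.
pose off (a b : {ffun 'I_k -> 'I_N}) := [forall l, (l != p) ==> (a l == b l)].
rewrite [RHS](bigID (off a)) /= [X in _ = _ + X]big1 ?addr0; last first.
  by move=> c /negbTE h; rewrite !entry_tens -/(off a c) h mulr0n mul0r.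
pose upd x : {ffun 'I_k -> 'I_N} := [ffun l => if l == p then x else a l].
rewrite (reindex_onto upd (fun c => c p)) /=; last first.
  move=> c /forallP h; apply/ffunP=> l; rewrite ffunE.
  by case: eqP => [->//|/eqP h1]; apply/eqP; apply: (implyP (h l)).
have offu x b' : off (upd x) b' = off a b'.
  by apply: eq_forallb => l; rewrite ffunE; case: (l == p).
have offa x : off a (upd x).
  by apply/forallP=> l; apply/implyP; rewrite ffunE => /negbTE->.
rewrite entry_tens mxE -sumrMnl; apply: eq_big => [x|x _].
  by rewrite offa ffunE !eqxx.
by rewrite !entry_tens -!/(off _ _) offa offu ffunE eqxx mulr1n mulrnAr.
Qed.
End Local1.

Section MapLocal.
Variables (A B : pzRingType) (f : {rmorphism A -> B}) (N k : nat).

Lemma map_loc2 (p p' : 'I_k) (X : 'M[A]_(N * N)) :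
  map_mx f (loc2 p p' X) = loc2 p p' (map_mx f X).
Proof. by apply/matrixP=> s t; rewrite !mxE rmorphMn. Qed.

Lemma map_mxZ_scalar m c (X : 'M[A]_m) : map_mx f (c *: X) = (f c)%:M * map_mx f X.
Proof. by rewrite map_mxZ -mul_scalar_mx. Qed.
End MapLocal.

Section Triple.
Variables (B : pzRingType) (N : nat).
Implicit Types X Y Z : 'M[B]_(N * N).

(** The entries of an operator on V (x) V, indexed by pairs. *)
Definition coef X (i j x y : 'I_N) : B := X (mxtens_index (i, j)) (mxtens_index (x, y)).

(** The entries of X_12 Y_23 Z_12. *)
Definition coef121 X Y Z (a0 a1 a2 b0 b1 b2 : 'I_N) : B :=
  \sum_x \sum_y coef X a0 a1 x y * \sum_z coef Y y a2 z b2 * coef Z x z b0 b1.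

(** The entries of X_23 Y_12 Z_23. *)
Definition coef212 X Y Z (a0 a1 a2 b0 b1 b2 : 'I_N) : B :=
  \sum_x \sum_y coef X a1 a2 x y * \sum_z coef Y a0 x b0 z * coef Z z y b1 b2.

Section Fixed.
Variables (k : nat) (p0 p1 p2 : 'I_k).
Hypotheses (h01 : p0 != p1) (h12 : p1 != p2) (h02 : p0 != p2).
Local Notation state := {ffun 'I_k -> 'I_N}.

(** Multi-indices that coincide except possibly at p0, p1 and p2. *)
Definition agree_off3 (a b : state) :=
  [forall l, [&& l != p0, l != p1 & l != p2] ==> (a l == b l)].

Lemma entry121 X Y Z a b :
  entry (loc2 p0 p1 X *m loc2 p1 p2 Y *m loc2 p0 p1 Z) a b =
  coef121 X Y Z (a p0) (a p1) (a p2) (b p0) (b p1) (b p2) *+ agree_off3 a b.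
Proof.
have h20 : p2 != p0 by rewrite eq_sym.
have h21 : p2 != p1 by rewrite eq_sym.
have h10 : p1 != p0 by rewrite eq_sym.
rewrite -mulmxA entry_loc2M // -sumrMnl; apply: eq_bigr => x _.
rewrite -sumrMnl; apply: eq_bigr => y _; rewrite -mulrnAr; congr (_ * _).
rewrite entry_loc2M // -sumrMnl; apply: eq_bigr => z _.
rewrite (bigD1 (b p2)) //= big1 ?addr0 => [|w nw].
  rewrite entry_tens -mulrnAr !ffunE !eqxx (negbTE h10) (negbTE h20) (negbTE h21).
  rewrite ?(negbTE h01) ?(negbTE h02).
  congr (_ * (_ *+ nat_of_bool _)); apply: eq_forallb => l; rewrite !ffunE.
  case: (eqVneq l p0) => //= n0; case: (eqVneq l p1) => //= n1.
  by case: (eqVneq l p2) => [->|] //=; rewrite eqxx.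
rewrite entry_tens (_ : agree_off2 _ _ _ _ = false) ?mulr0 //.
apply/negbTE/forallPn; exists p2; rewrite !ffunE (negbTE h20) (negbTE h21) eqxx /=.
by [].
Qed.

Lemma entry212 X Y Z a b :
  entry (loc2 p1 p2 X *m loc2 p0 p1 Y *m loc2 p1 p2 Z) a b =
  coef212 X Y Z (a p0) (a p1) (a p2) (b p0) (b p1) (b p2) *+ agree_off3 a b.
Proof.
have h20 : p2 != p0 by rewrite eq_sym.
have h21 : p2 != p1 by rewrite eq_sym.
have h10 : p1 != p0 by rewrite eq_sym.
rewrite -mulmxA entry_loc2M // -sumrMnl; apply: eq_bigr => x _.
rewrite -sumrMnl; apply: eq_bigr => y _; rewrite -mulrnAr; congr (_ * _).
rewrite entry_loc2M // (bigD1 (b p0)) //= [X in _ + X]big1 ?addr0 => [|w nw].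
  rewrite -sumrMnl; apply: eq_bigr => z _.
  rewrite entry_tens -mulrnAr !ffunE !eqxx (negbTE h10) (negbTE h20) (negbTE h21).
  rewrite ?(negbTE h01) ?(negbTE h02).
  congr (_ * (_ *+ nat_of_bool _)); apply: eq_forallb => l; rewrite !ffunE.
  case: (eqVneq l p1) => //=; rewrite ?andbF // => n1.
  case: (eqVneq l p2) => //=; rewrite ?andbF // => n2.
  by case: (eqVneq l p0) => [->|] //=; rewrite eqxx.
rewrite big1 // => z _; rewrite entry_tens (_ : agree_off2 _ _ _ _ = false) ?mulr0 //.
by apply/negbTE/forallPn; exists p0; rewrite !ffunE h01 h02 eqxx.
Qed.
End Fixed.

Definition pos1 : 'I_3 := inord 0.
Definition pos2 : 'I_3 := inord 1.
Definition pos3 : 'I_3 := inord 2.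

Lemma pos_neq : [/\ pos1 != pos2, pos2 != pos3 & pos1 != pos3].
Proof. by rewrite -!(inj_eq val_inj) /= !inordK. Qed.

Lemma agree_off3_full (a b : {ffun 'I_3 -> 'I_N}) : agree_off3 pos1 pos2 pos3 a b.
Proof.
apply/forallP=> l; apply/implyP; rewrite -!(inj_eq val_inj) /= !inordK //.
by case: l => -[|[|[|l]]].
Qed.

(** The multi-index (x0, x1, x2) for three tensor factors. *)
Definition state3 (x0 x1 x2 : 'I_N) : {ffun 'I_3 -> 'I_N} :=
  [ffun l => tnth [tuple x0; x1; x2] l].

Lemma state3E x0 x1 x2 : let a := state3 x0 x1 x2 in
  [/\ a pos1 = x0, a pos2 = x1 & a pos3 = x2].
Proof. by split; rewrite ffunE (tnth_nth x0) /= inordK. Qed.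

Lemma coef_braid X Y Z X' Y' Z' :
  at2 2 1 X *m at2 2 2 Y *m at2 2 1 Z = at2 2 2 X' *m at2 2 1 Y' *m at2 2 2 Z' ->
  forall a0 a1 a2 b0 b1 b2,
  coef121 X Y Z a0 a1 a2 b0 b1 b2 = coef212 X' Y' Z' a0 a1 a2 b0 b1 b2.
Proof.
have [h01 h12 h02] := pos_neq.
move=> e a0 a1 a2 b0 b1 b2.
have := congr1 (fun W => entry W (state3 a0 a1 a2) (state3 b0 b1 b2)) e.
rewrite [LHS]entry121 // [RHS]entry212 // agree_off3_full !mulr1n.
by have [-> -> ->] := state3E a0 a1 a2; have [-> -> ->] := state3E b0 b1 b2.
Qed.

(** The braid relation holds in any two adjacent pairs of factors once it holds
    in three factors. *)
Lemma at2_braid X n i : (0 < i < n)%N ->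
  at2 2 1 X *m at2 2 2 X *m at2 2 1 X = at2 2 2 X *m at2 2 1 X *m at2 2 2 X ->
  at2 n i X *m at2 n i.+1 X *m at2 n i X = at2 n i.+1 X *m at2 n i X *m at2 n i.+1 X.
Proof.
move=> /andP[i0 lin] e; apply: entryP => a b.
have h : [/\ inord i.-1 != inord i :> 'I_n.+1, inord i != inord i.+1 :> 'I_n.+1
   & inord i.-1 != inord i.+1 :> 'I_n.+1].
  by rewrite -!(inj_eq val_inj) /= !inordK; (try split); lia.
by case: h => h01 h12 h02; rewrite [LHS]entry121 // [RHS]entry212 // (coef_braid e).
Qed.

(** The entries of X_12 Y_23. *)
Lemma entry12 (k : nat) (p0 p1 p2 : 'I_k) X Y a b : p0 != p1 -> p1 != p2 -> p0 != p2 ->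
  entry (loc2 p0 p1 X *m loc2 p1 p2 Y) a b =
  (\sum_y coef X (a p0) (a p1) (b p0) y * coef Y y (a p2) (b p1) (b p2))
    *+ agree_off3 p0 p1 p2 a b.
Proof.
move=> h01 h12 h02.
have h20 : p2 != p0 by rewrite eq_sym.
have h21 : p2 != p1 by rewrite eq_sym.
have h10 : p1 != p0 by rewrite eq_sym.
rewrite entry_loc2M // (bigD1 (b p0)) //= [X in _ + X]big1 ?addr0 => [|w nw].
  rewrite -sumrMnl; apply: eq_bigr => z _.
  rewrite entry_tens -mulrnAr !ffunE !eqxx (negbTE h10) (negbTE h20) (negbTE h21).
  congr (_ * (_ *+ nat_of_bool _)); apply: eq_forallb => l; rewrite !ffunE.
  case: (eqVneq l p1) => //=; rewrite ?andbF // => n1.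
  case: (eqVneq l p2) => //=; rewrite ?andbF // => n2.
  by case: (eqVneq l p0) => [->|] //=; rewrite eqxx.
rewrite big1 // => z _; rewrite entry_tens (_ : agree_off2 _ _ _ _ = false) ?mulr0 //.
by apply/negbTE/forallPn; exists p0; rewrite !ffunE h01 h02 eqxx.
Qed.

Lemma coef_ptrace X Y i k j l :
  coef (ptrace2_3 (at2 2 1 X *m at2 2 2 Y)) i k j l =
  \sum_x \sum_y coef X i x j y * coef Y y k x l.
Proof.
have [h01 h12 h02] := pos_neq.
rewrite /coef mxE !mxtens_indexK; apply: eq_bigr => x _ /=.
transitivity (entry (at2 2 1 X *m at2 2 2 Y) (state3 i x k) (state3 j x l)) => //.
rewrite [LHS]entry12 // agree_off3_full mulr1n.
by have [-> -> ->] := state3E i x k; have [-> -> ->] := state3E j x l.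
Qed.

Lemma coef_flip i j x y : coef (flip_mx B N) i j x y = ((i == y) && (j == x))%:R.
Proof. by rewrite /coef mxE !mxtens_indexK. Qed.
End Triple.

Section At2.
Variables (F : fieldType) (N n : nat).

Lemma at2_neq i : (0 < i <= n)%N -> inord i.-1 != inord i :> 'I_n.+1.
Proof. by move=> h; rewrite -(inj_eq val_inj) /= !inordK; lia. Qed.

Lemma at2M i (X Y : 'M[F]_(N * N)) : (0 < i <= n)%N ->
  at2 n i (X *m Y) = at2 n i X *m at2 n i Y :> 'T[F]_(N, n.+1).
Proof. by move=> hi; apply: loc2M; apply: at2_neq. Qed.

Lemma at2_scalar i (c : F) : (0 < i <= n)%N -> at2 n i (c%:M : 'M_(N * N)) = c%:M.
Proof. by move=> hi; apply: loc2_scalar; apply: at2_neq. Qed.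

Lemma at2_far (X Y : 'M[F]_(N * N)) i j : (0 < i)%N -> (i.+1 < j <= n)%N ->
  at2 n i X *m at2 n j Y = at2 n j Y *m at2 n i X.
Proof.
move=> i0 hj; apply: (supported_comm (supported_loc2 _ _ _) (supported_loc2 _ _ _)).
  by move=> l /orP[] /eqP->; rewrite /= -!(inj_eq val_inj) /= !inordK; lia.
by move=> *; apply: mulrC.
Qed.

End At2.

(** * The matrix C of the R-trace commutes with R *)

Section Trace.
Variables (F : fieldType) (N : nat).
Implicit Types R Ri Psi X Y : 'M[F]_(N * N).

Lemma coefM X Y i j k l :
  coef (X *m Y) i j k l = \sum_x \sum_y coef X i j x y * coef Y x y k l.
Proof. by rewrite /coef mxE sum_mxtens. Qed.

Lemma coefP X Y : (forall i j k l, coef X i j k l = coef Y i j k l) -> X = Y.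
Proof.
move=> e; apply/matrixP=> s t; rewrite -(mxtens_unindexK s) -(mxtens_unindexK t).
by case: (mxtens_unindex s) => i j; case: (mxtens_unindex t) => k l; apply: e.
Qed.

Lemma coef1 i j k l : coef (1%:M : 'M[F]_(N * N)) i j k l = ((i == k) && (j == l))%:R.
Proof. by rewrite /coef mxE mxtens_index_eq. Qed.

Lemma coef_tens (X Y : 'M[F]_N) i j k l : coef (X *t Y) i j k l = X i k * Y j l.
Proof. by rewrite /coef tensmxE. Qed.

(** If P is a left inverse of T, then T Q = v gives Q = P v. *)
Lemma solve_left (U : finType) (P T : U -> U -> F) (Q v : U -> F) :
  (forall u w, \sum_s P u s * T s w = (u == w)%:R) ->
  (forall s, \sum_u T s u * Q u = v s) -> forall u, Q u = \sum_s P u s * v s.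
Proof.
move=> PT TQ u.
transitivity (\sum_s \sum_w P u s * T s w * Q w).
  rewrite exchange_big /= (bigD1 u) //= [X in _ + X]big1 ?addr0 => [|w nw].
    by rewrite -mulr_suml PT eqxx mul1r.
  by rewrite -mulr_suml PT eq_sym (negbTE nw) mul0r.
apply: eq_bigr => s _; rewrite -TQ mulr_sumr.
by apply: eq_bigr => w _; rewrite mulrA.
Qed.

Section Half.
Variables (R Ri Psi : 'M[F]_(N * N)).
Hypotheses (RRi : R *m Ri = 1%:M) (RiR : Ri *m R = 1%:M).
Hypothesis braidR : braiding R.
Hypothesis skewR : skew_inverse R Psi.

Local Notation C := (ptrace2_2 Psi).

(** The first skew-inverse relation: the partial transposes of R and Psi are
    mutually inverse matrices. *)
Lemma skew1 i k j l :
  \sum_x \sum_y coef R i x j y * coef Psi y k x l = ((i == l) && (k == j))%:R.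
Proof. by rewrite -coef_ptrace skewR.1 coef_flip. Qed.

Lemma skew2 i k j l :
  \sum_x \sum_y coef Psi i x j y * coef R y k x l = ((i == l) && (k == j))%:R.
Proof. by rewrite -coef_ptrace skewR.2 coef_flip. Qed.

Lemma ptrace2_2E i j : C i j = \sum_x coef Psi i x j x.
Proof. by rewrite mxE. Qed.

(** Tr_(2) R_12 C_2 = I. *)
Lemma Rtrace_R i j : \sum_x \sum_y coef R i x j y * C y x = (i == j)%:R.
Proof.
transitivity (\sum_k \sum_x \sum_y coef R i x j y * coef Psi y k x k).
  rewrite [RHS]exchange_big /=; apply: eq_bigr => x _.
  rewrite [RHS]exchange_big /=; apply: eq_bigr => y _.
  by rewrite ptrace2_2E mulr_sumr.
rewrite (eq_bigr _ (fun k _ => skew1 i k j k)) (bigD1 i) //= eqxx big1 ?addr0 // => k nk.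
by rewrite eq_sym (negbTE nk).
Qed.

Lemma braid_mixed_at2 :
  at2 2 1 Ri *m at2 2 2 R *m at2 2 1 R = at2 2 2 R *m at2 2 1 R *m at2 2 2 Ri.
Proof.
have inv i : (0 < i <= 2)%N ->
    at2 2 i Ri *m at2 2 i R = 1%:M /\ at2 2 i R *m at2 2 i Ri = 1%:M.
  move=> hi; have h := at2_neq hi.
  by split; apply: (etrans (esym (loc2M h _ _))); rewrite ?RRi ?RiR loc2_scalar.
have [i1 j1] := inv 1%N isT; have [i2 j2] := inv 2%N isT.
rewrite -[LHS]mulmx1 -j2 !mulmxA; congr (_ *m _).
rewrite -!mulmxA; rewrite (mulmxA (at2 2 2 R)) -braidR.
by rewrite -!mulmxA (mulmxA _ (at2 2 1 R)) i1 mul1mx.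
Qed.

Let G := Ri *m (1%:M *t C).

Lemma coefG z y b c : coef G z y b c = \sum_t coef Ri z y b t * C t c.
Proof.
rewrite coefM (bigD1 b) //= [X in _ + X]big1 ?addr0 => [|x nx].
  by apply: eq_bigr => t _; rewrite coef_tens mxE eqxx mul1r.
by apply: big1 => t _; rewrite coef_tens mxE (negbTE nx) mul0r mulr0.
Qed.

(** Tr_(3) R_23 R_12 R_23^-1 C_3 = I, which follows from the braid relation in
    the form R_23 R_12 R_23^-1 = R_12^-1 R_23 R_12. *)
Lemma Rtrace_braid a0 a1 b0 b1 :
  \sum_(zx : 'I_N * 'I_N) coef R a0 zx.2 b0 zx.1 *
    (\sum_(yc : 'I_N * 'I_N) coef R a1 yc.2 zx.2 yc.1 * coef G zx.1 yc.1 b1 yc.2)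
  = ((a0 == b0) && (a1 == b1))%:R.
Proof.
have -> : ((a0 == b0) && (a1 == b1))%:R =
    \sum_a2 \sum_b2 coef121 Ri R R a0 a1 a2 b0 b1 b2 * C b2 a2.
  rewrite -coef1 -RiR coefM.
  transitivity (\sum_x \sum_y coef Ri a0 a1 x y *
    \sum_z (\sum_a2 \sum_b2 coef R y a2 z b2 * C b2 a2) * coef R x z b0 b1).
    apply: eq_bigr => x _; apply: eq_bigr => y _; congr (_ * _).
    rewrite (bigD1 y) //= Rtrace_R eqxx mul1r big1 ?addr0 // => z nz.
    by rewrite Rtrace_R eq_sym (negbTE nz) mul0r.
  rewrite /coef121.
  rewrite [RHS]pair_bigA /=; apply/esym.
  under eq_bigr do rewrite mulr_suml.
  rewrite exchange_big /=; apply: eq_bigr => x _.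
  under eq_bigr do rewrite mulr_suml.
  rewrite exchange_big /=; apply: eq_bigr => y _.
  under eq_bigr do rewrite -mulrA mulr_suml.
  rewrite -mulr_sumr; congr (_ * _); rewrite exchange_big /=; apply: eq_bigr => z _.
  by rewrite pair_bigA /= mulr_suml; apply: eq_bigr => ab _; rewrite mulrAC.
under [RHS]eq_bigr do under eq_bigr do rewrite (coef_braid braid_mixed_at2).
transitivity (\sum_c \sum_x \sum_y \sum_z
    coef R a0 x b0 z * (coef R a1 c x y * coef G z y b1 c)).
  rewrite -(pair_bigA _ (fun z x => coef R a0 x b0 z * (\sum_yc
    coef R a1 yc.2 x yc.1 * coef G z yc.1 b1 yc.2))) /=.
  rewrite exchange_big [RHS]exchange_big /=; apply: eq_bigr => x _.
  rewrite [RHS]exchange_big /= (eq_bigr (fun z => \sum_y \sum_c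
    coef R a0 x b0 z * (coef R a1 c x y * coef G z y b1 c))); last first.
    by move=> z _; rewrite mulr_sumr pair_bigA.
  rewrite exchange_big /=; apply: eq_bigr => y _; exact: exchange_big.
apply: eq_bigr => c _.
under [RHS]eq_bigr do rewrite mulr_suml.
rewrite [RHS]exchange_big /=; apply: eq_bigr => x _.
under [RHS]eq_bigr do rewrite mulr_suml.
rewrite [RHS]exchange_big /=; apply: eq_bigr => y _.
under [RHS]eq_bigr do rewrite -mulrA mulr_suml mulr_sumr.
rewrite [RHS]exchange_big /=; apply: eq_bigr => z _.
rewrite coefG !mulr_sumr; apply: eq_bigr => t _.
by rewrite !mulrA (mulrC (coef R a0 x b0 z)).
Qed.

(** R^-1 C_2 = C_1 Psi_21, in coefficients. *)
Lemma Rinv_C i k b l : coef G i k b l = \sum_j C i j * coef Psi k j l b.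
Proof.
pose T (s u : 'I_N * 'I_N) := coef R s.2 u.2 s.1 u.1.
pose P (u s : 'I_N * 'I_N) := coef Psi u.1 s.1 u.2 s.2.
have PT u w : \sum_s P u s * T s w = (u == w)%:R.
  case: u w => [i0 j0] [l0 k0]; rewrite xpair_eqE (eq_sym j0) -skew2 pair_bigA.
  by apply: eq_bigr => -[].
have E2 a1 b1 := solve_left PT (fun s => Rtrace_braid s.2 a1 s.1 b1).
(* contraction with Psi in the first pair of indices *)
have E3 a1 j : \sum_(yc : 'I_N * 'I_N) T (j, a1) yc * coef G i yc.1 b yc.2 =
    C i j * (a1 == b)%:R.
  rewrite [LHS](E2 a1 b (i, j)) ptrace2_2E mulr_suml -(pair_bigA _ (fun x y =>
    coef Psi i x j y * ((y == x) && (a1 == b))%:R)) /=.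
  apply: eq_bigr => x _; rewrite (bigD1 x) //= eqxx big1 ?addr0 // => y ny.
  by rewrite (negbTE ny) mulr0.
(* a second contraction with Psi isolates R^-1 C_2 *)
rewrite (solve_left PT (Q := fun yc => coef G i yc.1 b yc.2) (fun s => E3 s.2 s.1) (k, l)).
rewrite -(pair_bigA _ (fun x y => coef Psi k x l y * (C i x * (y == b)%:R))) /=.
apply: eq_bigr => j _; rewrite (bigD1 b) //= eqxx mulr1 mulrC big1 ?addr0 // => y ny.
by rewrite (negbTE ny) !mulr0.
Qed.
End Half.

Lemma at2_tr n i X : (at2 n i X)^T = at2 n i X^T.
Proof.
apply: entryP => a b; transitivity (entry (at2 n i X) b a); first by rewrite /entry mxE.
rewrite !entry_tens mxE; congr (_ *+ nat_of_bool _).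
by apply: eq_forallb => l; rewrite (eq_sym (a l)).
Qed.

Lemma coef_tr X i j k l : coef X^T i j k l = coef X k l i j.
Proof. by rewrite /coef mxE. Qed.

Lemma skew_inverse_tr R Psi : skew_inverse R Psi -> skew_inverse R^T Psi^T.
Proof.
move=> h; split; apply: coefP => i k j l; rewrite coef_ptrace coef_flip.
  rewrite andbC (eq_sym k) (eq_sym i) -(skew1 h) exchange_big /=.
  by apply: eq_bigr => x _; apply: eq_bigr => y _; rewrite !coef_tr.
rewrite andbC (eq_sym k) (eq_sym i) -(skew2 h) exchange_big /=.
by apply: eq_bigr => x _; apply: eq_bigr => y _; rewrite !coef_tr.
Qed.

Lemma ptrace2_2_tr Psi : ptrace2_2 Psi^T = (ptrace2_2 Psi)^T.
Proof. by apply/matrixP=> i j; rewrite !mxE; apply: eq_bigr => x _; rewrite mxE. Qed.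

Lemma braiding_tr R : braiding R -> braiding R^T.
Proof. by move=> h; rewrite /braiding -!at2_tr -!trmx_mul !mulmxA h. Qed.

(** R commutes with C (x) C.  Both sides of R^-1 C_1 C_2 = C_1 C_2 R^-1 equal
    C_1 Psi_21 C_1; the right one by transposing Rinv_C. *)
Lemma tens_C_comm R Ri Psi :
  R *m Ri = 1%:M -> Ri *m R = 1%:M -> braiding R -> skew_inverse R Psi ->
  let C := ptrace2_2 Psi in R *m (C *t C) = (C *t C) *m R.
Proof.
move=> RRi RiR bR sR C.
have hl := Rinv_C RRi RiR bR sR.
have hr i k b l : coef ((1%:M *t C) *m Ri) b l i k = \sum_j C j i * coef Psi l b k j.
  have RRi' : R^T *m Ri^T = 1%:M by rewrite -trmx_mul RiR trmx1.
  have RiR' : Ri^T *m R^T = 1%:M by rewrite -trmx_mul RRi trmx1.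
  have := Rinv_C RRi' RiR' (braiding_tr bR) (skew_inverse_tr sR) i k b l.
  rewrite ptrace2_2_tr -{1}[1%:M]trmx1 -trmx_tens -trmx_mul coef_tr => ->.
  by apply: eq_bigr => j _; rewrite mxE coef_tr.
have CC1 : C *t C = (1%:M *t C) *m (C *t 1%:M) by rewrite tensmx_mul mulmx1 mul1mx.
have CC2 : C *t C = (C *t 1%:M) *m (1%:M *t C) by rewrite tensmx_mul mulmx1 mul1mx.
suff e : Ri *m (C *t C) = (C *t C) *m Ri.
  by rewrite -[LHS]mulmx1 -RiR -!mulmxA (mulmxA _ _ R) -e !mulmxA RRi mul1mx.
rewrite {1}CC1 {1}CC2 [LHS]mulmxA -[RHS]mulmxA; apply: coefP => i k m l.
rewrite !coefM.
transitivity (\sum_b \sum_j C i j * coef Psi k j l b * C b m).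
  apply: eq_bigr => b _; rewrite (bigD1 l) //= big1 ?addr0 => [|t nt].
    by rewrite hl coef_tens [1%:M _ _]mxE eqxx mulr1 mulr_suml.
  by rewrite coef_tens [1%:M _ _]mxE (negbTE nt) !mulr0.
rewrite exchange_big /=; apply: eq_bigr => b _.
rewrite [RHS](bigD1 k) //= [X in _ = _ + X]big1 ?addr0 => [|t nt].
  rewrite hr coef_tens [1%:M _ _]mxE eqxx mulr1 mulr_sumr; apply: eq_bigr => j _.
  by rewrite -mulrA (mulrC (coef _ _ _ _ _)).
by rewrite coef_tens [1%:M _ _]mxE eq_sym (negbTE nt) mulr0 mul0r.
Qed.
End Trace.

(** * The projectors *)

Section QInt.
Variables (F : fieldType) (q : F).
Hypotheses (q0 : q != 0) (lam0 : q - q^-1 != 0).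

Lemma qint1 : qint q 1 = 1.
Proof. by rewrite /qint expr1 divff. Qed.

Let qq0 : q * q - 1 != 0.
Proof. by move: lam0; rewrite -(inj_eq (mulfI q0)) mulrBr mulr0 mulfV. Qed.

Lemma qintS k : qint q k.+1 = q ^+ k + q^-1 * qint q k.
Proof.
have xk : q ^+ k != 0 by rewrite expf_neq0.
by rewrite /qint exprS; field; rewrite q0 xk qq0.
Qed.

(** The shift q^k k_q of the theorem is capelli_scalar at index k + 1. *)
Lemma qint_shiftE k : q ^+ k * qint q k = (q - q^-1)^-1 * ((- q) ^+ k.*2 - 1).
Proof.
have xk : q ^+ k != 0 by rewrite expf_neq0.
rewrite exprNn -signr_odd odd_double mul1r -muln2 exprM /qint.
by field; rewrite xk q0 qq0.
Qed.

Lemma qint_opp_inv k : qint (- q^-1) k = - (-1) ^+ k * qint q k.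
Proof.
have xk : q ^+ k != 0 by rewrite expf_neq0.
rewrite /qint (exprNn q^-1) exprVn -signr_odd.
have qq1 : 1 + - q * q != 0 by rewrite mulNr -oppr_eq0 opprB.
by case: (odd k); rewrite ?expr0 ?expr1; field; rewrite xk q0 qq0 qq1 ?oppr_eq0 oner_neq0.
Qed.
End QInt.

Section SkewStep.
Variables (F : fieldType) (m : nat) (q a u v : F) (P A r s : 'M[F]_m).
Hypotheses (q0 : q != 0) (v0 : v != 0).
Hypothesis PP : P *m P = P.
Hypothesis rP : r *m P = P *m r.
Hypothesis AE : A = v^-1 *: (P *m (a%:M - u *: s) *m P).
Hypothesis AA : A *m A = A.
Hypothesis sA : s *m A = - q^-1 *: A.
Hypothesis rsr : r *m s *m r = s *m r *m s.
Hypothesis rr : r *m r = 1%:M + (q - q^-1) *: r.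

(** The induction step for skew_spec.  Here A, P, s and r are to be thought of
    as A^(k-1), A^(k-2), R_(k-2) and R_(k-1), and a = q^(k-2), u = (k-2)_q,
    v = (k-1)_q.  Expanding the left A in r A r A and in A r A expresses both in
    terms of A, r A and P s r A, and the last one cancels. *)
Lemma skew_step :
  r *m (A *m ((q * a)%:M - v *: r) *m A) = - q^-1 *: (A *m ((q * a)%:M - v *: r) *m A).
Proof.
have vA : v *: A = a *: P - u *: (P *m s *m P).
  rewrite AE scalerA divff // scale1r mulmxBr mulmxBl mul_mx_scalar -scalemxAl PP.
  by rewrite -scalemxAr -scalemxAl.
have PA : P *m A = A.
  by rewrite AE -scalemxAr !mulmxA PP.
have PrA : P *m r *m A = r *m A by rewrite -rP -mulmxA PA.
have rrA : r *m r *m A = A + (q - q^-1) *: (r *m A).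
  by rewrite rr mulmxDl mul1mx -scalemxAl.
set X := r *m A in PrA rrA *; set Y := P *m s *m X.
have vArA : v *: (A *m X) = a *: X - u *: Y.
  rewrite scalemxAl vA mulmxBl -!scalemxAl /X mulmxA PrA /Y.
  by rewrite -(mulmxA (P *m s)) (mulmxA P r) PrA.
have vrArA : v *: (r *m (A *m X)) = a *: A + (a * (q - q^-1)) *: X + (q^-1 * u) *: Y.
  rewrite scalemxAr vArA mulmxBr -!scalemxAr {1}/X mulmxA rrA scalerDr scalerA.
  suff -> : r *m Y = - q^-1 *: Y by rewrite scalerA mulrN scaleNr opprK (mulrC u).
  transitivity (P *m (r *m s *m r) *m A); first by rewrite /Y /X !mulmxA rP.
  by rewrite rsr /Y /X -!mulmxA sA -!scalemxAr.
have BE : A *m ((q * a)%:M - v *: r) *m A = (q * a) *: A - v *: (A *m X).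
  rewrite mulmxBr mulmxBl mul_mx_scalar -scalemxAl AA.
  by rewrite -scalemxAr -scalemxAl -mulmxA.
rewrite BE mulmxBr -!scalemxAr vrArA scalerBr vArA.
apply/matrixP=> i j; rewrite !mxE -/X.
by field.
Qed.
End SkewStep.

Section Antisymmetrizer.
Variables (F : fieldType) (N n : nat) (q : F) (R : 'M[F]_(N * N)).
Hypotheses (q0 : q != 0) (lam0 : q - q^-1 != 0).
Hypothesis hqint : forall k, (1 <= k)%N -> qint q k != 0.
Hypothesis heckeR : hecke_symmetry q R.

Lemma hecke_sqrR : R *m R = 1%:M + (q - q^-1) *: R.
Proof.
have [_] := heckeR; rewrite mulmxDr !mulmxBl -!scalar_mxM mulfV //.
rewrite mul_scalar_mx mul_mx_scalar => /eqP; rewrite addrA subr_eq0 => /eqP <-.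
by rewrite scalerBl [RHS]addrA addrAC.
Qed.

Lemma R_unit : R *m (R - (q - q^-1)%:M) = 1%:M /\ (R - (q - q^-1)%:M) *m R = 1%:M.
Proof.
by rewrite mulmxBr mulmxBl mul_mx_scalar mul_scalar_mx hecke_sqrR addrK.
Qed.

Lemma unitR : R \in unitmx.
Proof. by case: (mulmx1_unit R_unit.1). Qed.

Lemma invR : invmx R = R - (q - q^-1)%:M.
Proof. by rewrite -[RHS]mul1mx -(mulVmx unitR) -mulmxA R_unit.1 mulmx1. Qed.

Local Notation r := (fun i => at2 n i R).

Lemma at2_unit i : (0 < i <= n)%N -> at2 n i R *m at2 n i (invmx R) = 1%:M.
Proof. by move=> hi; rewrite -at2M // mulmxV ?unitR // at2_scalar. Qed.

Lemma at2_inv i : (0 < i <= n)%N -> invmx (at2 n i R) = at2 n i (invmx R).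
Proof.
move=> hi; have [u _] := mulmx1_unit (at2_unit hi).
by rewrite -[LHS]mulmx1 -(at2_unit hi) mulmxA mulVmx // mul1mx.
Qed.

Lemma at2_hecke i : (0 < i <= n)%N ->
  at2 n i R = at2 n i (invmx R) + (q - q^-1)%:M.
Proof.
move=> hi; rewrite -(at2_scalar _ _ hi) -[RHS]loc2D invR subrK //.
Qed.

Lemma at2_sqr i : (0 < i <= n)%N ->
  at2 n i R *m at2 n i R = 1%:M + (q - q^-1) *: at2 n i R.
Proof.
by move=> hi; rewrite {2}at2_hecke // mulmxDr at2_unit // mul_mx_scalar.
Qed.

Local Notation A := (skew_symmetrizer n q R).

Lemma skew_comm k j : (k < j <= n)%N -> at2 n j R *m A k = A k *m at2 n j R.
Proof.
elim: k => [|[|k] IH] hj; [by rewrite mulmx1 mul1mx..|].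
have IH' : at2 n j R *m A k.+1 = A k.+1 *m at2 n j R by apply: IH; lia.
have e : at2 n j R *m ((q ^+ k.+1)%:M - qint q k.+1 *: at2 n k.+1 R) =
  ((q ^+ k.+1)%:M - qint q k.+1 *: at2 n k.+1 R) *m at2 n j R.
  rewrite mulmxBr mulmxBl mul_mx_scalar mul_scalar_mx -scalemxAl -scalemxAr.
  by rewrite (at2_far R R (ltn0Sn k) hj).
rewrite [A k.+2]/= -/(A k.+1) -scalemxAl -scalemxAr; congr (_ *: _).
by rewrite !mulmxA IH' -(mulmxA _ (at2 n j R)) e !mulmxA -(mulmxA _ (at2 n j R)) IH' !mulmxA.
Qed.

(** A^(k) is an idempotent, and R_i A^(k) = - q^-1 A^(k) for i < k. *)
Lemma skew_spec k : (0 < k <= n.+1)%N ->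
  A k *m A k = A k /\ (forall i, (0 < i < k)%N -> at2 n i R *m A k = - q^-1 *: A k).
Proof.
elim/ltn_ind: k => -[|[|k]] // IH /andP[_ hk].
  by rewrite mulmx1; split=> // -[|i].
have [AA rA] : A k.+1 *m A k.+1 = A k.+1 /\
    (forall i, (0 < i < k.+1)%N -> at2 n i R *m A k.+1 = - q^-1 *: A k.+1).
  by apply: IH; lia.
have rA' i : (0 < i < k.+2)%N -> at2 n i R *m A k.+2 = - q^-1 *: A k.+2.
  case/andP=> i0; rewrite ltnS leq_eqVlt => /orP[/eqP->|lik]; last first.
    rewrite [A k.+2]/= -/(A k.+1) -scalemxAr !mulmxA rA ?i0 //.
    by rewrite -!scalemxAl !scalerA mulrC.
  rewrite [A k.+2]/= -/(A k.+1) -scalemxAr.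
  set X := A k.+1 *m _ *m A k.+1; suff -> : at2 n k.+1 R *m X = - q^-1 *: X.
    by rewrite !scalerA mulrC.
  (* A^(2) is computed directly: the inductive step needs a generator R_(k-1) *)
  rewrite /X; case: k IH hk AA rA {i i0 X} => [|k] IH hk AA rA.
    rewrite !mul1mx !mulmx1 qint1 // scale1r mulmxBr mul_mx_scalar at2_sqr //.
    apply/matrixP=> s t; rewrite !mxE expr1; field => //.
  have [PP _] : A k.+1 *m A k.+1 = A k.+1 /\
    (forall i, (0 < i < k.+1)%N -> at2 n i R *m A k.+1 = - q^-1 *: A k.+1).
    by apply: IH; lia.
  rewrite exprS; apply: (@skew_step _ _ _ _ (qint q k.+1) _ (A k.+1) _ _ (at2 n k.+1 R)) => //.
  - exact: hqint.
  - by apply: skew_comm; lia.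
  - by apply: rA; lia.
  - by apply: esym; apply: at2_braid; [lia|case: heckeR].
  - by apply: at2_sqr; lia.
split=> //.
have A1 : A k.+1 *m A k.+2 = A k.+2.
  by rewrite [A k.+2]/= -/(A k.+1) -scalemxAr !mulmxA AA.
have BE : A k.+2 = (qint q k.+2)^-1 *: (A k.+1 *m
  ((q ^+ k.+1)%:M - qint q k.+1 *: at2 n k.+1 R) *m A k.+1) by [].
move: (A k.+2) BE (rA' k.+1) A1 => B BE rB A1.
rewrite {1}BE -scalemxAl -!mulmxA A1 mulmxBl mul_scalar_mx -scalemxAl.
rewrite rB ?ltnSn // scalerA -scalerBl mulrN opprK (mulrC _ q^-1) -qintS // -scalemxAr A1.
by rewrite scalerA mulVf ?scale1r // hqint.
Qed.
End Antisymmetrizer.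

(** The symmetrizer for q is the skew-symmetrizer for - q^-1. *)
Lemma symmetrizerE (F : fieldType) (N n : nat) (q : F) (R : 'M[F]_(N * N)) k :
  q != 0 -> q - q^-1 != 0 ->
  symmetrizer n q R k = skew_symmetrizer n (- q^-1) R k.
Proof.
move=> q0 lam0; elim: k => [|[|k] IH]; [exact: erefl..|].
have sym B (p := k.+1) : symmetrizer n q R p = B ->
   symmetrizer n q R p.+1 = (qint q p.+1)^-1 *:
    (B *m ((q ^- p)%:M + qint q p *: at2 n p R) *m B) by move=> <-.
have skew B (p := k.+1) : skew_symmetrizer n (- q^-1) R p = B ->
   skew_symmetrizer n (- q^-1) R p.+1 = (qint (- q^-1) p.+1)^-1 *:
    (B *m (((- q^-1) ^+ p)%:M - qint (- q^-1) p *: at2 n p R) *m B) by move=> <-.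
rewrite (sym _ IH) (skew _ (erefl _)).
move: (skew_symmetrizer _ _ _ _) (at2 _ _ _) => B r.
rewrite !qint_opp_inv // (exprNn q^-1) exprVn (exprS (-1) k.+1) mulN1r opprK.
move: (qint q k.+2) (qint q k.+1) (q ^- k.+1) => u v x.
set e := (-1) ^+ k.+1; have ee : e * e = 1 by rewrite -expr2 sqrr_sign.
have eV : e^-1 = e by rewrite /e -exprVn invrN1.
have -> : (e * x)%:M - (- e * v) *: r = e *: (x%:M + v *: r).
  by rewrite mulNr scaleNr opprK scalerDr scalerA scale_scalar_mx.
rewrite -scalemxAr -scalemxAl scalerA (invfM e) eV.
by rewrite mulrAC ee mul1r.
Qed.

(** * The R-trace on the quantum double *)

Section ProdC.
Variables (F : fieldType) (N n : nat) (R : 'M[F]_(N * N)) (C : 'M[F]_N).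
Hypothesis RCC : R *m (C *t C) = (C *t C) *m R.

Lemma at1_at2_comm j i : (0 < i <= n)%N -> (0 < j <= n.+1)%N -> j != i -> j != i.+1 ->
  GRing.comm (at2 n i R) (at1 n j C).
Proof.
move=> hi hj ji ji1.
apply: (supported_comm (supported_loc2 _ _ _) (supported_loc1 _ _)).
  by move=> l /orP[] /eqP->; rewrite /= -!(inj_eq val_inj) /= !inordK; lia.
by move=> *; apply: mulrC.
Qed.

Lemma at1_pair i : (0 < i <= n)%N ->
  at1 n i C * at1 n i.+1 C = at2 n i (C *t C) :> 'T[F]_(N, n.+1).
Proof.
move=> hi; have h := at2_neq hi.
rewrite -[at1 n i C]/(loc1 _ _) -[at1 n i.+1 C]/(loc1 _ _) -(loc2_left h) -(loc2_right h).
by rewrite -[LHS](loc2M h) tensmx_mul mulmx1 mul1mx.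
Qed.

(** R_i commutes with C_1 ... C_(n+1): only the factors i and i + 1 matter. *)
Lemma prod_at1_comm i : (0 < i <= n)%N ->
  GRing.comm (at2 n i R) (\prod_(1 <= j < n.+2) at1 n j C).
Proof.
move=> hi; rewrite (@big_cat_nat _ _ _ i) /=; [|lia..].
rewrite (@big_cat_nat _ _ _ i.+2 i) /=; [|lia..].
apply: commrM.
  by rewrite big_nat; apply: commr_prod => j hj; apply: at1_at2_comm; lia.
apply: commrM; last first.
  by rewrite big_nat; apply: commr_prod => j hj; apply: at1_at2_comm; lia.
rewrite big_ltn // big_nat1 at1_pair //.
by apply: etrans (at2M _ _ hi); apply: etrans (esym (at2M _ _ hi)) _; rewrite RCC.
Qed.
End ProdC.

Section QD.
Variables (F : fieldType) (N n : nat) (R Psi : 'M[F]_(N * N)).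
Local Notation f := (qscal R).
Local Notation T := 'T[qdouble R]_(N, n.+1).

Lemma qscal_mul c z : f c * z = c *: z.
Proof. by rewrite /pres_scal -pres_scalerAl mul1r. Qed.

Lemma qscalC c z : GRing.comm (f c) z.
Proof. by rewrite /GRing.comm qscal_mul /pres_scal -pres_scalerAr mulr1. Qed.

Lemma scalar_qscalC c (X : T) : GRing.comm ((f c)%:M : T) X.
Proof.
rewrite /GRing.comm -[LHS]/(_ *m _) -[RHS]/(_ *m _) mul_scalar_mx.
apply/matrixP=> s t; rewrite !mxE (bigD1 t) //= mxE eqxx mulr1n big1 ?addr0 ?qscalC // => u nu.
by rewrite mxE (negbTE nu) mulr0n mulr0.
Qed.

Lemma Rtrace_zmod : zmod_morphism (@Rtrace F N R Psi n).
Proof. by move=> X Y; rewrite /Rtrace mulrBr raddfB. Qed.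
HB.instance Definition _ := GRing.isZmodMorphism.Build _ _ (@Rtrace F N R Psi n) Rtrace_zmod.

Lemma Rtrace_scalar c (X : T) : Rtrace Psi ((f c)%:M * X) = c *: Rtrace Psi X.
Proof.
rewrite /Rtrace mulrA -scalar_qscalC -mulrA -[_ * _ in LHS]/(_ *m _) mul_scalar_mx.
by rewrite mxtraceZ qscal_mul.
Qed.

(** The trace is cyclic with respect to scalar matrices, even though the other
    matrix has noncommuting entries. *)
Lemma mxtrace_qscal m (X : 'M[F]_m) (Y : 'M[qdouble R]_m) :
  \tr (map_mx f X * Y) = \tr (Y * map_mx f X).
Proof.
transitivity (\sum_i \sum_j Y j i * map_mx f X i j).
  by apply: eq_bigr => i _; rewrite mxE; apply: eq_bigr => j _; rewrite mxE qscalC.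
by rewrite exchange_big /=; apply: eq_bigr => i _; rewrite [RHS]mxE.
Qed.

Variable q : F.
Hypotheses (q0 : q != 0) (lam0 : q - q^-1 != 0).
Hypothesis hqint : forall k, (1 <= k)%N -> qint q k != 0.
Hypothesis heckeR : hecke_symmetry q R.
Hypothesis skewR : skew_inverse R Psi.

Let r i : T := map_mx f (at2 n i R).
Let ri i : T := map_mx f (invmx (at2 n i R)).

Let RRi : R *m invmx R = 1%:M. Proof. exact: mulmxV (unitR q0 heckeR). Qed.
Let RiR : invmx R *m R = 1%:M. Proof. exact: mulVmx (unitR q0 heckeR). Qed.

Lemma qd_rK i : (0 < i <= n)%N -> r i * ri i = 1.
Proof.
move=> hi; rewrite -[LHS]/(_ *m _) -map_mxM (at2_inv q0 heckeR) //.
by rewrite (at2_unit q0 heckeR) // map_mx1.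
Qed.

Lemma qd_riK i : (0 < i <= n)%N -> ri i * r i = 1.
Proof.
move=> hi; rewrite -[LHS]/(_ *m _) -map_mxM (at2_inv q0 heckeR) // -at2M //.
by rewrite RiR at2_scalar // map_mx1.
Qed.

Lemma qd_braid i : (0 < i < n)%N -> r i * r i.+1 * r i = r i.+1 * r i * r i.+1.
Proof.
move=> hi; rewrite -[LHS]/(_ *m _ *m _) -[RHS]/(_ *m _ *m _) -!map_mxM.
by rewrite at2_braid //; case: heckeR.
Qed.

Lemma qd_far i j : (0 < i)%N -> (i.+1 < j <= n)%N -> GRing.comm (r i) (r j).
Proof.
move=> i0 hj; rewrite /GRing.comm -[LHS]/(_ *m _) -[RHS]/(_ *m _) -!map_mxM.
by congr map_mx; apply: at2_far.
Qed.

Lemma qd_comm (X : 'M[qdouble R]_N) i : (1 < i <= n)%N -> GRing.comm (r i) (at1 n 1 X).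
Proof.
move=> hi; rewrite /r map_loc2.
apply: (supported_comm (supported_loc2 _ _ _) (supported_loc1 _ _)).
  by move=> l /orP[] /eqP->; rewrite /= -!(inj_eq val_inj) /= !inordK; lia.
move=> s t s' t'; rewrite !mxE.
by apply: commr_sym; apply: commrMn; apply: commr_sym; apply: qscalC.
Qed.

(** The copies of the quantum double are copies in the sense of the first part. *)
Lemma qd_copies X i : mx_copy n X i = copies r ri (at1 n 1 X) i.
Proof.
elim: i => [|[|i] IH]; [exact: erefl..|].
by rewrite (copiesS _ _ _ (ltn0Sn i)) -IH.
Qed.

Section Low.
Hypothesis n0 : (0 < n)%N.
Let h : inord 0 != inord 1 :> 'I_n.+1.
Proof. exact: (@at2_neq n 1). Qed.
Let loc := @loc2 (qdouble R) N n.+1 (inord 0) (inord 1).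

Let locX (X : 'M[qdouble R]_N) : loc (X *t 1%:M) = at1 n 1 X.
Proof. exact: loc2_left. Qed.
Let locr : loc (map_mx f R) = r 1.
Proof. by rewrite /r map_loc2. Qed.
Let locri : loc (map_mx f (invmx R)) = ri 1.
Proof. by rewrite /ri (at2_inv q0 heckeR) // map_loc2. Qed.
Let locM X Y : loc (X *m Y) = loc X * loc Y.
Proof. exact: loc2M. Qed.

Lemma qd_DD1 : let D := at1 n 1 (qd_D R) in ri 1 * D * ri 1 * D = D * ri 1 * D * ri 1.
Proof.
move=> D; rewrite /D -(locX (qd_D R)) -locri -!locM.
exact: (congr1 loc (qd_DD R)).
Qed.

Lemma qd_DM1 : let D := at1 n 1 (qd_D R) in let M := at1 n 1 (qd_M R) in
  D * r 1 * M = r 1 * M * ri 1 * D * ri 1 + 1.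
Proof.
move=> D M; rewrite /D /M -(locX (qd_D R)) -(locX (qd_M R)) -locri -locr -!locM.
have e1 : loc 1%:M = 1 by exact: loc2_scalar.
rewrite -[X in _ + X]e1 -[RHS]loc2D.
exact: (congr1 loc (qd_DM R)).
Qed.
End Low.

Lemma qd_L1 : at1 n 1 (qd_L R) = at1 n 1 (qd_M R) * at1 n 1 (qd_D R).
Proof. exact: loc1M. Qed.

(** The R-trace is cyclic with respect to R_i. *)
Lemma Rtrace_r i (Z : T) : (0 < i <= n)%N -> Rtrace Psi (r i * Z) = Rtrace Psi (Z * r i).
Proof.
move=> hi; rewrite /Rtrace.
have -> : \prod_(1 <= j < n.+2) map_mx f (at1 n j (ptrace2_2 Psi)) =
    map_mx f (\prod_(1 <= j < n.+2) at1 n j (ptrace2_2 Psi)) :> T.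
  by rewrite rmorph_prod.
set P := \prod_(1 <= j < n.+2) _.
have c : r i * map_mx f P = map_mx f P * r i.
  have RCC := tens_C_comm RRi RiR heckeR.1 skewR.
  by rewrite -[LHS]map_mxM -[RHS]map_mxM; congr map_mx; apply: prod_at1_comm.
move: (map_mx f P) c => Q c.
have e : Q * (r i * Z) = r i * (Q * Z).
  exact: etrans (mulrA _ _ _) (etrans (congr1 ( *%R^~ Z) (esym c)) (esym (mulrA _ _ _))).
apply: etrans (congr1 mxtrace e) _.
apply: etrans (mxtrace_qscal _ _) _.
exact: (congr1 mxtrace (esym (mulrA _ _ _))).
Qed.

(** The skew-symmetric identity over an arbitrary field; the factor (- q)^(k(k-1))
    keeps it in a form that can be applied to - q^-1 in place of q. *)
Theorem skew_capelli :
  Rtrace Psi (map_mx f (skew_symmetrizer n q R n.+1) * \prod_(1 <= j < n.+2)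
     (mx_copy n (qd_L R) j + (f (q ^+ j.-1 * qint q j.-1))%:M))
  = (- q) ^+ (n.+1 * n) *: Rtrace Psi (map_mx f (skew_symmetrizer n q R n.+1) *
     ((\prod_(1 <= j < n.+2) mx_copy n (qd_M R) j) *
      (\prod_(1 <= j < n.+2) mx_copy n (qd_D R) (n.+2 - j)))).
Proof.
set A := map_mx f _.
(* q^-1 is minus the eigenvalue of R_i on A, hence R_i^-1 acts on A as - q *)
pose mu : T := (f (- q))%:M.
pose lam : T := (f (q - q^-1))%:M.
pose lami : T := (f (q - q^-1)^-1)%:M.
have lamK : lami * lam = 1.
  by rewrite /lami /lam -[LHS]/(_ *m _) -scalar_mxM -rmorphM mulVf // rmorph1.
have riA i : (0 < i <= n)%N -> ri i * A = mu * A.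
  move=> hi; rewrite /A /mu -map_mxZ_scalar -[LHS]map_mxM; congr map_mx.
  have [_ rA] := skew_spec q0 lam0 hqint heckeR (leqnn n.+1 : (0 < n.+1 <= n.+1)%N).
  rewrite (at2_inv q0 heckeR) // -[RHS]mul1mx -(at2_scalar _ _ hi) -RiR at2M //.
  by rewrite -mulmxA -scalemxAr rA // scalerA mulrNN mulfV // scale1r.
have hecke i : (0 < i <= n)%N -> r i = ri i + lam.
  move=> hi; rewrite /r (at2_hecke q0 heckeR) // map_mxD map_scalar_mx.
  by rewrite /ri (at2_inv q0 heckeR).
have := capelli_tr qd_rK qd_riK qd_braid qd_far (@qd_comm (qd_M R)) (@qd_comm (qd_D R))
  qd_DD1 qd_DM1 (scalar_qscalC _) (scalar_qscalC _) (scalar_qscalC _) lamK hecke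
  (tr := @Rtrace F N R Psi n) Rtrace_r riA.
rewrite -qd_L1 /desc_prod /capelli_scalar => H.
have copiesE X j : copies r ri (at1 n 1 X) j = mx_copy n X j by rewrite qd_copies.
have scX c e : (f (c ^+ e))%:M = (f c)%:M ^+ e :> T by rewrite !rmorphXn.
have sc j : lami * (mu ^+ j.*2 - 1) = (f (q ^+ j * qint q j))%:M.
  rewrite (qint_shiftE q0 lam0) rmorphM rmorphB rmorph1 scalar_mxM raddfB /=.
  rewrite [X in _ *m (X - _)]scX; exact: erefl.
have Hs X : Rtrace Psi (mu ^+ (n.+1 * n) * X) = (- q) ^+ (n.+1 * n) *: Rtrace Psi X.
  by rewrite -scX; apply: Rtrace_scalar.
have {}H := etrans H (Hs _).
apply: etrans (etrans _ H) _.
  apply: (congr1 (fun W => Rtrace Psi (A * W))); apply: eq_bigr => j _.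
  by apply: congr2; [rewrite copiesE|rewrite sc].
apply: (congr1 (fun W => _ *: Rtrace Psi (A * W))); apply: congr2.
  by apply: eq_bigr => j _; rewrite copiesE.
by apply: eq_bigr => j _; rewrite copiesE.
Qed.
End QD.

(** The Hecke condition is symmetric in q and - q^-1. *)
Lemma hecke_symmetry_opp_inv (F : fieldType) N (q : F) (R : 'M[F]_(N * N)) :
  hecke_symmetry q R -> hecke_symmetry (- q^-1) R.
Proof.
case=> braidR h; split=> //; move: h.
have -> : (- q^-1)%:M - R = - (q^-1%:M + R) by rewrite raddfN opprD.
have -> : (- q^-1)^-1%:M + R = - (q%:M - R).
  by rewrite invrN invrK raddfN opprB addrC.
rewrite mulNmx mulmxN opprK => <-.
rewrite [LHS]mulmxDl !mulmxBr [RHS]mulmxDr !mulmxBl.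
by rewrite !(scalar_mxC q) (scalar_mxC q^-1 R).
Qed.

Unset Implicit Arguments.

(* The integer k >= 1 of the two identities is n.+1. *)
Theorem corollary5 (K : realType) (N : nat) (q : K[i]) (R Psi : 'M[K[i]]_(N * N))
    (hN : (1 <= N)%N)
    (hq0 : q != 0) (hq1 : q != 1) (hqN1 : q != -1)
    (hqint : forall k : nat, (1 <= k)%N -> qint q k != 0)
    (hR : hecke_symmetry q R)
    (hPsi : skew_inverse R Psi) (n : nat) :
  let M_ := mx_copy n (qd_M R) in
  let D_ := mx_copy n (qd_D R) in
  let L_ := mx_copy n (qd_L R) in
  let A := map_mx (qscal R) (skew_symmetrizer n q R n.+1) in
  let S := map_mx (qscal R) (symmetrizer n q R n.+1) in
  let MD := (\prod_(1 <= j < n.+2) M_ j) * (\prod_(1 <= j < n.+2) D_ (n.+2 - j)%N) in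
  Rtrace Psi (A * \prod_(1 <= j < n.+2)
                    (L_ j + (qscal R (q ^+ j.-1 * qint q j.-1))%:M))
    = q ^+ (n.+1 * n) *: Rtrace Psi (A * MD)
  /\
  Rtrace Psi (S * \prod_(1 <= j < n.+2)
                    (L_ j - (qscal R (q ^- j.-1 * qint q j.-1))%:M))
    = q ^- (n.+1 * n) *: Rtrace Psi (S * MD).
Proof.
have lam0 : q - q^-1 != 0.
  apply/eqP=> e; have /eqP : (q - 1) * (q + 1) = q * (q - q^-1).
    by rewrite -subr_sqr expr1n expr2 mulrBr mulfV.
  by rewrite e mulr0 mulf_eq0 subr_eq0 addr_eq0 (negbTE hq1) (negbTE hqN1).
have Q0 : - q^-1 != 0 by rewrite oppr_eq0 invr_eq0.
have lamQ : - q^-1 - (- q^-1)^-1 != 0 by rewrite invrN invrK opprK addrC.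
have Qint k : (1 <= k)%N -> qint (- q^-1) k != 0.
  by move=> hk; rewrite qint_opp_inv // mulf_neq0 ?hqint // oppr_eq0 signr_eq0.
move=> M_ D_ L_ A S MD; split.
  have H := skew_capelli n hq0 lam0 hqint hR hPsi.
  apply: (etrans H).
  (* the exponent is even *)
  rewrite (exprNn q) -signr_odd oddM /= andNb expr0 mul1r; exact: erefl.
have SE : S = map_mx (qscal R) (skew_symmetrizer n (- q^-1) R n.+1).
  by rewrite /S symmetrizerE.
have := skew_capelli n Q0 lamQ Qint (hecke_symmetry_opp_inv hR) hPsi.
rewrite opprK exprVn -SE => H; apply: (etrans _ H).
apply: (congr1 (fun W => Rtrace Psi (S * W))); apply: eq_bigr => j _.
apply: congr2; first exact: erefl.
have -> : (- q^-1) ^+ j.-1 * qint (- q^-1) j.-1 = - (q ^- j.-1 * qint q j.-1).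
  rewrite (qint_opp_inv hq0 lam0) (exprNn q^-1) exprVn mulNr mulrN mulrACA.
  by rewrite -expr2 sqrr_sign mul1r.
by rewrite !raddfN.
Qed.
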